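(* Suppose that for every integer $n\ge 2$, each D-map in $\mathbb R[x_1,\dots,x_n]^n$ is injective as a map $\mathbb R^n\to\mathbb R^n$. Then for every integer $n\ge 2$, each Keller map $\mathbf P\in\mathbb C[x_1,\dots,x_n]^n$ is injective as a map $\mathbb C^n\to\mathbb C^n$, and so is an automorphism of $\mathbb C^n$.
   Context: Let $\mathbb K$ be $\mathbb R$ or $\mathbb C$. A polynomial vector $\mathcal P=(\mathcal P_1,\dots,\mathcal P_n)\in\mathbb K[x_1,\dots,x_n]^n$ is regarded as a map $\mathbb K^n\to\mathbb K^n$; it is a Keller map if the determinant of its Jacobian matrix $[\partial\mathcal P_j/\partial x_k]_{j,k}$ is a nonzero constant in $\mathbb K$, and it is an automorphism of $\mathbb K^n$ if its inverse exists and is also a polynomial map. For a vector $V=(v_1,\dots,v_n)^T$, $V^{*3}:=(v_1^3,\dots,v_n^3)^T$. A D-map (Drużkowski map) in $\mathbb R[x_1,\dots,x_n]^n$ is a Keller map of the form $X+(\mathcal A X)^{*3}$ with $X=(x_1,\dots,x_n)^T$ and $\mathcal A\in\mathbb R^{n\times n}$. *)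

(* Defs.v *)
From HB Require Import structures.
From mathcomp Require Import all_boot all_order all_algebra.
From mathcomp Require Import reals complex mpoly.

Set Implicit Arguments.
Unset Strict Implicit.
Unset Printing Implicit Defensive.

Import GRing.Theory.

Local Open Scope ring_scope.

Definition polyvec (K : fieldType) (n : nat) := 'cV[{mpoly K[n]}]_n.

Definition polymap (K : fieldType) (n : nat) (P : polyvec K n)
  (x : 'cV[K]_n) : 'cV[K]_n := \col_i (P i 0).@[fun j => x j 0].

Definition jacobian (K : fieldType) (n : nat) (P : polyvec K n) :
  'M[{mpoly K[n]}]_n := \matrix_(j, k) (P j 0)^`M(k).

Definition keller (K : fieldType) (n : nat) (P : polyvec K n) : Prop :=
  exists2 c : K, c != 0 & \det (jacobian P) = c%:MP.

Definition automorphism (K : fieldType) (n : nat) (P : polyvec K n) : Prop :=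
  exists Q : polyvec K n,
    cancel (polymap P) (polymap Q) /\ cancel (polymap Q) (polymap P).

Definition Xvec (K : fieldType) (n : nat) : polyvec K n := \col_i 'X_i.

Definition cube (S : comNzRingType) (n : nat) (V : 'cV[S]_n) : 'cV[S]_n :=
  map_mx (fun v => v ^+ 3) V.

Definition dmap (K : fieldType) (n : nat) (P : polyvec K n) : Prop :=
  keller P /\
  exists A : 'M[K]_n,
    P = Xvec K n + cube (map_mx (@mpolyC n K) A *m Xvec K n).

(* Main.v *)
(* Injectivity. A complex Keller map is a real Keller map in twice as many variables. Adding
   variables and composing with shears lowers its degree to 3 and then makes it of the form
   x + H(x) with H homogeneous cubic; a collision of the original map is kept at each step.
   By polarization H(x) = C(Ax)^{*3} with C onto, and y |-> y + (ACy)^{*3} is then a D-map,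
   with the same Jacobian determinant, which has a collision as soon as x + H(x) has one.

   Inverse. Let F be an injective complex Keller map. By the Nullstellensatz and det JF <> 0,
   X_i - Y_i lies in the ideal generated by the F_j(X) - F_j(Y). Applying to the X-part of
   this relation a K[F]-linear functional that kills 1 but not X_i, and setting Y = X, gives
   a contradiction unless X_i lies in K(F). So q(F) X_i = p(F); take q of least degree. If
   q(F) is not constant, it has a prime factor P, and the ideal of all r with P | r(F)
   contains p and q. As F is etale this ideal has height one, hence is principal, and p and q
   have a common factor, contrary to the choice of q. *)

Require Import Defs.
From HB Require Import structures.
From mathcomp Require Import all_boot all_order all_algebra.
From mathcomp Require Import boolp classical_sets cardinality set_interval.
From mathcomp Require Import reals complex mpoly ring zify.
From mathcomp Require lebesgue_measure.

Set Implicit Arguments.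
Unset Strict Implicit.
Unset Printing Implicit Defensive.

Import Order.TTheory GRing.Theory Num.Theory.
Local Open Scope ring_scope.

(** * Multivariate polynomials as univariate ones *)

(** In the steps that add variables, the old space sits in the new one as a slice on which the new
    map takes the values of the old one, padded by constants; this is how collisions survive. That
    the determinants stay constant is read off from block matrices.

    The functional phi gives a contradiction because it commutes with multiplication by F_j(X) -
    F_j(Y), which vanishes at Y = X: the relation becomes phi(X_i) - phi(1) X_i = 0. If X_i is not
    in K(F), then 1 and X_i are independent over K(F), so phi may be prescribed on both. To stay
    inside polynomials, phi is a partial map given by its graph, defined at least on the finitely
    many coefficients of the relation, and its values are multiplied by elements of K[F] when an
    extension would create denominators.

    Height one comes from differentiation: modulo P, the gradients of all elements of the contracted
    ideal are parallel, whereas an element prime to a minimal one would yield, by elimination of a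
    variable, members of ever lower degree. *)

Lemma mpoly_ring_ind (R : nzRingType) n (P : {mpoly R[n]} -> Prop) :
  (forall c, P c%:MP) -> (forall i, P 'X_i) ->
  (forall p q, P p -> P q -> P (p + q)) ->
  (forall p q, P p -> P q -> P (p * q)) -> forall p, P p.
Proof.
move=> PC PX PD PM p; elim/mpolyind: p => [|c m p _ _ IH]; first by rewrite -mpolyC0.
apply: (PD) => //; rewrite -mul_mpolyC; apply: (PM) => //.
rewrite mpolyXE_id; elim/big_ind: _ => [|u v|i _]; [exact: PC|exact: PM|].
by elim: (m i) => [|k IHk]; [exact: PC | rewrite exprS; exact: (PM)].
Qed.

Lemma mpoly_rmorph_eq (R : nzRingType) n (S : nzRingType) (f g : {rmorphism {mpoly R[n]} -> S}) :
  (forall c, f c%:MP = g c%:MP) -> (forall i, f 'X_i = g 'X_i) -> f =1 g.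
Proof.
move=> fgC fgX; elim/mpoly_ring_ind => // p q fp fq.
- by rewrite !rmorphD fp fq.
- by rewrite !rmorphM fp fq.
Qed.

Section Uni.
Variables (R : comNzRingType) (n : nat) (j : 'I_n.+1).

(** The variable [j] singled out is arbitrary: factoriality uses the first one, but elimination has
    to remove a variable along which some derivative does not vanish. *)
Definition uni_var (i : 'I_n.+1) : {poly {mpoly R[n]}} :=
  if unlift j i is Some k then ('X_k)%:P else 'X.

Definition uni : {mpoly R[n.+1]} -> {poly {mpoly R[n]}} :=
  mmap (polyC \o @mpolyC n R) uni_var.
HB.instance Definition _ := GRing.RMorphism.copy uni (mmap (polyC \o @mpolyC n R) uni_var).

Definition omit_var : {mpoly R[n]} -> {mpoly R[n.+1]} :=
  comp_mpoly [tuple 'X_(lift j i) | i < n].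
HB.instance Definition _ := GRing.RMorphism.copy omit_var
  (comp_mpoly [tuple 'X_(lift j i) | i < n]).

Definition multi : {poly {mpoly R[n]}} -> {mpoly R[n.+1]} :=
  horner_eval 'X_j \o map_poly omit_var.
HB.instance Definition _ := GRing.RMorphism.copy multi (horner_eval 'X_j \o map_poly omit_var).

Lemma uniC c : uni c%:MP = c%:MP%:P.
Proof. by rewrite /uni mmapC. Qed.

Lemma uniX i : uni 'X_i = uni_var i.
Proof. by rewrite /uni mmapX mmap1U. Qed.

Lemma omit_varC c : omit_var c%:MP = c%:MP.
Proof. exact: comp_mpolyC. Qed.

Lemma omit_varX i : omit_var 'X_i = 'X_(lift j i).
Proof. by rewrite /omit_var comp_mpolyXU -tnth_nth tnth_mktuple. Qed.

Lemma multiC p : multi p%:P = omit_var p.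
Proof. by rewrite /multi /= map_polyC /horner_eval hornerC. Qed.

Lemma multiX : multi 'X = 'X_j.
Proof. by rewrite /multi /= map_polyX /horner_eval hornerX. Qed.

Lemma uniK : cancel uni multi.
Proof.
apply: (mpoly_rmorph_eq (f := multi \o uni) (g := idfun)) => [c|i] /=.
  by rewrite uniC multiC omit_varC.
rewrite uniX /uni_var; case: unliftP => [k ->|->]; last exact: multiX.
by rewrite multiC omit_varX.
Qed.

Lemma uni_omit p : uni (omit_var p) = p%:P.
Proof.
move: p; apply: (mpoly_rmorph_eq (f := uni \o omit_var) (g := polyC)) => [c|i] /=.
  by rewrite omit_varC uniC.
by rewrite omit_varX uniX /uni_var liftK.
Qed.

Lemma multiK : cancel multi uni.
Proof.
elim/poly_ind => [|p c IH]; first by rewrite !rmorph0.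
by rewrite !(rmorphD, rmorphM) /= IH multiX uniX multiC uni_omit /uni_var unlift_none.
Qed.

Lemma uni_inj : injective uni. Proof. exact: can_inj uniK. Qed.
Lemma uni_eq0 p : (uni p == 0) = (p == 0).
Proof. by rewrite -(inj_eq uni_inj) rmorph0. Qed.
Lemma omit_var_inj : injective omit_var.
Proof. by move=> p q /(congr1 uni); rewrite !uni_omit => /polyC_inj. Qed.

End Uni.

(** Characteristic zero supplies infinitely many integers: once the other variables are evaluated,
    they are too many roots for a nonzero polynomial in the first variable. *)
Lemma mpoly_eval0 (K : numFieldType) n (p : {mpoly K[n]}) :
  (forall v, p.@[v] = 0) -> p = 0.
Proof.
elim: n p => [|n IH] p p0.
  have := p0 (fun _ => 0); rewrite (nvar0_mpolyC p) mevalC => ->; exact: mpolyC0.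
apply: (@uni_inj _ _ ord0); rewrite rmorph0; apply/polyP => k; rewrite coef0.
apply: IH => v.
pose ev := @meval n K v.
have evE x q : (map_poly ev (uni ord0 q)).[x] =
   q.@[fun i => if unlift ord0 i is Some k then v k else x].
  move: q; apply: (mpoly_rmorph_eq
    (f := horner_eval x \o map_poly ev \o uni ord0)
    (g := meval (fun i => if unlift ord0 i is Some k then v k else x))) => [c|i] /=.
    by rewrite uniC mevalC map_polyC /horner_eval hornerC /ev /= mevalC.
  rewrite uniX mevalXU /uni_var /horner_eval; case: unlift => [l|]; rewrite /= ?map_polyC ?map_polyX ?hornerC ?hornerX //.
  by rewrite /ev /= mevalXU.
have q0 : map_poly ev (uni ord0 p) = 0.
  apply/eqP; apply: contraT => q_neq0.
  pose s := [seq (i%:R : K) | i <- iota 0 (size (map_poly ev (uni ord0 p)))].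
  have := max_poly_roots q_neq0 (rs := s); rewrite size_map size_iota ltnn; apply.
    by apply/allP => x _; rewrite rootE evE p0.
  rewrite map_inj_in_uniq ?iota_uniq // => a b _ _ /eqP; rewrite eqr_nat => /eqP //.
have := congr1 (fun q : {poly K} => q`_k) q0.
by rewrite coef_map coef0.
Qed.

Lemma mpoly_eval_inj (K : numFieldType) n (p q : {mpoly K[n]}) :
  (forall v, p.@[v] = q.@[v]) -> p = q.
Proof.
move=> pq; apply/eqP; rewrite -subr_eq0; apply/eqP/mpoly_eval0 => v.
by rewrite mevalB pq subrr.
Qed.

(** * Jacobians of polynomial maps *)

Lemma mderiv_var (R : nzRingType) n (i k : 'I_n) :
  ('X_i : {mpoly R[n]})^`M(k) = (i == k)%:R.
Proof.
rewrite mderivX mnm1E; have [->|_] := eqVneq i k; last exact: scale0r.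
by rewrite scale1r -[X in (X - _)%MM]add0m addmK mpolyX0.
Qed.

Lemma comp_mpoly_mderiv (R : comNzRingType) n k (p : {mpoly R[n]})
    (t : n.-tuple {mpoly R[k]}) (l : 'I_k) :
  (p \mPo t)^`M(l) = \sum_j (p^`M(j) \mPo t) * (tnth t j)^`M(l).
Proof.
elim/mpoly_ring_ind: p => [c|i|p q IHp IHq|p q IHp IHq].
- by rewrite comp_mpolyC mderivC big1 // => j _; rewrite mderivC rmorph0 mul0r.
- rewrite comp_mpolyXU -tnth_nth (bigD1 i) //= mderiv_var eqxx.
  rewrite rmorph1 mul1r big1 ?addr0 // => j ji.
  by rewrite mderiv_var eq_sym (negbTE ji) rmorph0 mul0r.
- rewrite comp_mpolyD mderivD IHp IHq -big_split; apply: eq_bigr => j _ /=.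
  by rewrite mderivD rmorphD mulrDl.
- rewrite rmorphM mderivM IHp IHq mulr_suml mulr_sumr -big_split.
  apply: eq_bigr => j _ /=; rewrite mderivM rmorphD !rmorphM /=.
  by rewrite mulrDl mulrAC !mulrA.
Qed.

Section Jacobian.
Variable K : numFieldType.

Definition pt n (x : 'cV[K]_n) : 'I_n -> K := fun j => x j 0.

(** Maps stay plain functions on column vectors, and polynomials occur only as witnesses, one per
    coordinate; compositions and blocks are then ordinary matrix formulas. *)
Definition hasjac n m (f : 'cV[K]_n -> 'cV[K]_m) (J : 'cV[K]_n -> 'M[K]_(m, n)) :=
  forall i, exists p : {mpoly K[n]}, (forall x, f x i 0 = p.@[pt x]) /\
    (forall x k, J x i k = p^`M(k).@[pt x]).

Definition had m (u v : 'cV[K]_m) : 'cV[K]_m := \col_i (u i 0 * v i 0).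
Definition dhad n m (u v : 'cV[K]_m) (A B : 'M[K]_(m, n)) : 'M[K]_(m, n) :=
  \matrix_(i, k) (u i 0 * B i k + A i k * v i 0).

Lemma eq_hasjac n m (f g : 'cV[K]_n -> 'cV[K]_m) J J' :
  f =1 g -> J =1 J' -> hasjac f J -> hasjac g J'.
Proof.
move=> fg JJ fJ i; have [p [pf pJ]] := fJ i; exists p.
by split=> [x|x k]; rewrite -?fg -?JJ.
Qed.

Lemma mpoly_pt_inj n (p q : {mpoly K[n]}) :
  (forall x, p.@[pt x] = q.@[pt x]) -> p = q.
Proof.
move=> pq; apply: mpoly_eval_inj => v.
have E : pt (\col_i v i) =1 v by move=> i; rewrite /pt mxE.
by rewrite -!(meval_eq _ E) pq.
Qed.

(** A polynomial is determined by its values, so every way of writing a map leads to the same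
    Jacobian. Determinants below are computed by changing the way. *)
Lemma hasjac_unique n m (f : 'cV[K]_n -> 'cV[K]_m) J J' :
  hasjac f J -> hasjac f J' -> J =1 J'.
Proof.
move=> fJ fJ' x; apply/matrixP => i k.
have [p [pf pJ]] := fJ i; have [q [qf qJ]] := fJ' i.
by rewrite pJ qJ; congr (_^`M(_).@[_]); apply: mpoly_pt_inj => y; rewrite -pf qf.
Qed.

Lemma hasjac_polymap n (P : polyvec K n) :
  hasjac (polymap P) (fun x => map_mx (meval (pt x)) (jacobian P)).
Proof. by move=> i; exists (P i 0); split=> [x|x k]; rewrite !mxE. Qed.

Lemma hasjac_cst n m (b : 'cV[K]_m) : hasjac (fun _ : 'cV[K]_n => b) (fun _ => 0).
Proof. by move=> i; exists (b i 0)%:MP; split=> [x|x k]; rewrite ?mderivC ?mevalC ?mxE ?meval0. Qed.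

Lemma hasjac_lin n m (A : 'M[K]_(m, n)) : hasjac (mulmx A) (fun _ => A).
Proof.
move=> i; exists (\sum_j A i j *: 'X_j); split=> [x|x k].
  by rewrite mxE raddf_sum; apply: eq_bigr => j _ /=; rewrite mevalZ mevalXU.
rewrite (raddf_sum (mderiv k)) (raddf_sum (meval (pt x))) (bigD1 k) //=.
rewrite (mderivZ k) mderiv_var eqxx mevalZ meval1 mulr1 big1 ?addr0 // => j jk.
by rewrite (mderivZ k) mderiv_var (negbTE jk) scaler0 meval0.
Qed.

Lemma hasjac_id n : hasjac (fun x : 'cV[K]_n => x) (fun _ => 1%:M).
Proof. by apply: eq_hasjac (hasjac_lin 1%:M) => // x; rewrite mul1mx. Qed.

Lemma hasjacD n m (f g : 'cV[K]_n -> 'cV[K]_m) J J' :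
  hasjac f J -> hasjac g J' -> hasjac (fun x => f x + g x) (fun x => J x + J' x).
Proof.
move=> fJ gJ i; have [p [pf pJ]] := fJ i; have [q [qg qJ]] := gJ i.
by exists (p + q); split=> [x|x k]; rewrite mxE ?pf ?qg ?pJ ?qJ ?mderivD mevalD.
Qed.

Lemma hasjac_had n m (f g : 'cV[K]_n -> 'cV[K]_m) J J' :
  hasjac f J -> hasjac g J' ->
  hasjac (fun x => had (f x) (g x)) (fun x => dhad (f x) (g x) (J x) (J' x)).
Proof.
move=> fJ gJ i; have [p [pf pJ]] := fJ i; have [q [qg qJ]] := gJ i.
exists (p * q); split=> [x|x k]; first by rewrite mxE mevalM pf qg.
by rewrite mxE mderivM mevalD !mevalM pf qg pJ qJ addrC.
Qed.

Lemma hasjac_comp n m k (f : 'cV[K]_m -> 'cV[K]_k) (g : 'cV[K]_n -> 'cV[K]_m) J J' :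
  hasjac f J -> hasjac g J' -> hasjac (f \o g) (fun x => J (g x) *m J' x).
Proof.
move=> fJ gJ i; have [p [pf pJ]] := fJ i.
have [q qP] := fin_all_exists gJ.
have qE x : (fun j => (tnth [tuple q j | j < m] j).@[pt x]) =1 pt (g x).
  by move=> j; rewrite tnth_mktuple /pt; have [-> _] := qP j.
exists (p \mPo [tuple q j | j < m]); split=> [x|x l].
  by rewrite comp_mpoly_meval (meval_eq _ (qE x)) -pf.
rewrite comp_mpoly_mderiv raddf_sum mxE; apply: eq_bigr => j _ /=.
rewrite mevalM comp_mpoly_meval (meval_eq _ (qE x)) pJ tnth_mktuple.
by have [_ ->] := qP j.
Qed.

Lemma hasjac_mull n m k (A : 'M[K]_(k, m)) (f : 'cV[K]_n -> 'cV[K]_m) J :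
  hasjac f J -> hasjac (fun x => A *m f x) (fun x => A *m J x).
Proof. exact: hasjac_comp (hasjac_lin A). Qed.

Lemma hasjac_col n m1 m2 (f : 'cV[K]_n -> 'cV[K]_m1) (g : 'cV[K]_n -> 'cV[K]_m2) J J' :
  hasjac f J -> hasjac g J' ->
  hasjac (fun x => col_mx (f x) (g x)) (fun x => col_mx (J x) (J' x)).
Proof.
move=> fJ gJ i; case: (split_ordP i) => j ->.
  have [p [pf pJ]] := fJ j; exists p.
  by split=> [x|x k]; rewrite col_mxEu.
have [p [pf pJ]] := gJ j; exists p.
by split=> [x|x k]; rewrite col_mxEd.
Qed.

Lemma usubmxE_mul n1 n2 p (A : 'M[K]_(n1 + n2, p)) : usubmx A = row_mx 1%:M 0 *m A.
Proof. by rewrite -{2}(vsubmxK A) mul_row_col mul1mx mul0mx addr0. Qed.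
Lemma dsubmxE_mul n1 n2 p (A : 'M[K]_(n1 + n2, p)) : dsubmx A = row_mx 0 1%:M *m A.
Proof. by rewrite -{2}(vsubmxK A) mul_row_col mul1mx mul0mx add0r. Qed.

Lemma hasjac_usub n1 n2 : hasjac (fun x : 'cV[K]_(n1 + n2) => usubmx x) (fun _ => row_mx 1%:M 0).
Proof. by apply: eq_hasjac (hasjac_lin _) => // x; rewrite usubmxE_mul. Qed.
Lemma hasjac_dsub n1 n2 : hasjac (fun x : 'cV[K]_(n1 + n2) => dsubmx x) (fun _ => row_mx 0 1%:M).
Proof. by apply: eq_hasjac (hasjac_lin _) => // x; rewrite dsubmxE_mul. Qed.

Definition kmap n (f : 'cV[K]_n -> 'cV[K]_n) :=
  exists J c, [/\ hasjac f J, c != 0 & forall x, \det (J x) = c].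

Lemma eq_kmap n (f g : 'cV[K]_n -> 'cV[K]_n) : f =1 g -> kmap f -> kmap g.
Proof. by move=> fg [J [c [fJ c0 dJ]]]; exists J, c; split=> //; apply: eq_hasjac fJ. Qed.

Lemma keller_kmap n (P : polyvec K n) : keller P <-> kmap (polymap P).
Proof.
split=> [[c c0 Pc]|[J [c [PJ c0 Jc]]]].
  exists (fun x => map_mx (meval (pt x)) (jacobian P)), c; split=> //.
    exact: hasjac_polymap.
  by move=> x; rewrite det_map_mx Pc /= mevalC.
exists c => //; apply: mpoly_pt_inj => x.
by rewrite mevalC -(Jc x) (hasjac_unique PJ (hasjac_polymap P)) det_map_mx.
Qed.

Lemma kmap_comp n (f g : 'cV[K]_n -> 'cV[K]_n) : kmap f -> kmap g -> kmap (f \o g).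
Proof.
move=> [J [c [fJ c0 dJ]]] [J' [c' [gJ c'0 dJ']]].
exists (fun x => J (g x) *m J' x), (c * c'); split; first exact: hasjac_comp.
  by rewrite mulf_neq0.
by move=> x; rewrite det_mulmx dJ dJ'.
Qed.

(** The Jacobian is block triangular with an identity corner, so the last variables act as
    parameters. *)
Lemma kmap_block n m (h : 'cV[K]_(n + m) -> 'cV[K]_n) J c :
  hasjac h J -> c != 0 -> (forall x, \det (lsubmx (J x)) = c) ->
  kmap (fun x => col_mx (h x) (dsubmx x)).
Proof.
move=> hJ c0 Jc; exists (fun x => col_mx (J x) (row_mx 0 1%:M)), c; split=> //.
  exact: (hasjac_col hJ (@hasjac_dsub n m)).
move=> x; rewrite -[J x]hsubmxK -/(block_mx _ _ _ _) det_ublock det1 mulr1; exact: Jc.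
Qed.

Lemma kmap_prod n m (f : 'cV[K]_n -> 'cV[K]_n) : kmap f ->
  kmap (fun x : 'cV[K]_(n + m) => col_mx (f (usubmx x)) (dsubmx x)).
Proof.
move=> [J [c [fJ c0 dJ]]].
apply: (@kmap_block _ _ (fun x => f (usubmx x)) (fun x => J (usubmx x) *m row_mx 1%:M 0) c) => //.
  exact: (hasjac_comp fJ (@hasjac_usub n m)).
by move=> x; rewrite mul_mx_row mulmx1 row_mxKl.
Qed.

Lemma kmap_ushear n m (s : 'cV[K]_m -> 'cV[K]_n) J : hasjac s J ->
  kmap (fun x : 'cV[K]_(n + m) => col_mx (usubmx x + s (dsubmx x)) (dsubmx x)).
Proof.
move=> sJ.
apply: (@kmap_block _ _ (fun x => usubmx x + s (dsubmx x))
   (fun x => row_mx 1%:M 0 + J (dsubmx x) *m row_mx 0 1%:M) 1); last first.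
- by move=> x; rewrite mul_mx_row mulmx0 add_row_mx addr0 row_mxKl det1.
- exact: oner_neq0.
- exact: (hasjacD (@hasjac_usub n m) (hasjac_comp sJ (@hasjac_dsub n m))).
Qed.

Lemma kmap_dshear n m (s : 'cV[K]_n -> 'cV[K]_m) J : hasjac s J ->
  kmap (fun x : 'cV[K]_(n + m) => col_mx (usubmx x) (dsubmx x + s (usubmx x))).
Proof.
move=> sJ; exists (fun x => col_mx (row_mx 1%:M 0) (row_mx 0 1%:M + J (usubmx x) *m row_mx 1%:M 0)), 1.
split; last 2 [exact: oner_neq0].
  apply: (hasjac_col (@hasjac_usub n m)).
  exact: (hasjacD (@hasjac_dsub n m) (hasjac_comp sJ (@hasjac_usub n m))).
move=> x; rewrite mul_mx_row mulmx0 mulmx1 add_row_mx addr0 add0r.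
by rewrite -/(block_mx _ _ _ _) det_lblock !det1 mulr1.
Qed.

End Jacobian.

(** * Reduction of the degree to three *)

Section Degree.
Variable K : numFieldType.

(** Degree at most [d] is encoded by exactly [d] affine factors multiplied entrywise, a missing
    factor being the constant 1. Unfolding splits off two affine factors in all coordinates at once,
    as [degree_step] requires. *)
Fixpoint affprod n m d (g : 'cV[K]_n -> 'cV[K]_m) : Prop :=
  if d is d'.+1 then
    exists A b h, affprod d' h /\ forall x, g x = had (A *m x + b) (h x)
  else forall x, g x = const_mx 1.

Definition polydeg n p d (f : 'cV[K]_n -> 'cV[K]_p) :=
  exists m (C : 'M_(p, m)) g, affprod d g /\ forall x, f x = C *m g x.

Lemma had1l m (v : 'cV[K]_m) : had (const_mx 1) v = v.
Proof. by apply/colP => i; rewrite !mxE mul1r. Qed.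

Lemma had1r m (v : 'cV[K]_m) : had v (const_mx 1) = v.
Proof. by apply/colP => i; rewrite !mxE mulr1. Qed.

Lemma hadA m (u v w : 'cV[K]_m) : had u (had v w) = had (had u v) w.
Proof. by apply/colP => i; rewrite !mxE mulrA. Qed.

Lemma had_col m1 m2 (a b : 'cV[K]_m1) (c d : 'cV[K]_m2) :
  had (col_mx a c) (col_mx b d) = col_mx (had a b) (had c d).
Proof.
by apply/colP => i; case: (split_ordP i) => j ->; rewrite mxE !(col_mxEu, col_mxEd) mxE.
Qed.

Lemma eq_affprod n m d (g h : 'cV[K]_n -> 'cV[K]_m) : g =1 h -> affprod d g -> affprod d h.
Proof.
case: d => [|d] gh /=; first by move=> g1 x; rewrite -gh.
by move=> [A [b [k [kP gE]]]]; exists A, b, k; split=> // x; rewrite -gh.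
Qed.

Lemma affprodS n m d (g : 'cV[K]_n -> 'cV[K]_m) : affprod d g -> affprod d.+1 g.
Proof.
by move=> gP; exists 0, (const_mx 1), g; split=> // x; rewrite mul0mx add0r had1l.
Qed.

Lemma affprod_le n m d e (g : 'cV[K]_n -> 'cV[K]_m) :
  (d <= e)%N -> affprod d g -> affprod e g.
Proof. by move=> /subnK <- gP; elim: (_ - _)%N => // k; exact: affprodS. Qed.

Lemma affprod_lin n m (A : 'M[K]_(m, n)) d (h : 'cV[K]_n -> 'cV[K]_m) :
  affprod d h -> affprod d.+1 (fun x => had (A *m x) (h x)).
Proof. by move=> hP; exists A, 0, h; split=> // x; rewrite addr0. Qed.

Lemma affprod_comp n k m d (g : 'cV[K]_n -> 'cV[K]_m) (A : 'M[K]_(n, k)) :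
  affprod d g -> affprod d (fun x => g (A *m x)).
Proof.
elim: d g => [|d IH] g /=; first by move=> g1 x; exact: g1.
move=> [B [c [h [hP gE]]]]; exists (B *m A), c, (fun x => h (A *m x)).
by split=> [|x]; [exact: IH | rewrite gE mulmxA].
Qed.

Lemma affprod_had n m d e (g h : 'cV[K]_n -> 'cV[K]_m) :
  affprod d g -> affprod e h -> affprod (d + e) (fun x => had (g x) (h x)).
Proof.
move=> gP hP; elim: d g gP => [|d IH] g /=.
  by move=> g1; apply: eq_affprod hP => x; rewrite g1 had1l.
move=> [A [b [k [kP gE]]]]; exists A, b, (fun x => had (k x) (h x)).
by split=> [|x]; [exact: IH | rewrite gE hadA].
Qed.

Lemma affprod_col n m1 m2 d (g : 'cV[K]_n -> 'cV[K]_m1) (h : 'cV[K]_n -> 'cV[K]_m2) :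
  affprod d g -> affprod d h -> affprod d (fun x => col_mx (g x) (h x)).
Proof.
elim: d g h => [|d IH] g h /=.
  by move=> g1 h1 x; rewrite g1 h1 col_mx_const.
move=> [A [b [k [kP gE]]]] [A' [b' [k' [kP' hE]]]].
exists (col_mx A A'), (col_mx b b'), (fun x => col_mx (k x) (k' x)).
by split=> [|x]; [exact: IH | rewrite mul_col_mx add_col_mx had_col gE hE].
Qed.

Lemma affprod_hasjac n m d (g : 'cV[K]_n -> 'cV[K]_m) :
  affprod d g -> exists J, hasjac g J.
Proof.
elim: d g => [|d IH] g /=.
  by move=> g1; exists (fun _ => 0); apply: eq_hasjac (hasjac_cst n (const_mx 1)) => // x; rewrite g1.
move=> [A [b [h [/IH [J hJ] gE]]]].
have AJ := hasjacD (hasjac_lin A) (hasjac_cst n b).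
by have := hasjac_had AJ hJ; eexists; apply: eq_hasjac (hasjac_had AJ hJ) => // x; rewrite gE.
Qed.

Lemma affprod_polydeg n m d (g : 'cV[K]_n -> 'cV[K]_m) : affprod d g -> polydeg d g.
Proof. by move=> gP; exists m, 1%:M, g; split=> // x; rewrite mul1mx. Qed.

Lemma eq_polydeg n p d (f g : 'cV[K]_n -> 'cV[K]_p) : f =1 g -> polydeg d f -> polydeg d g.
Proof. by move=> fg [m [C [h [hP fE]]]]; exists m, C, h; split=> // x; rewrite -fg. Qed.

Lemma polydeg_le n p d e (f : 'cV[K]_n -> 'cV[K]_p) :
  (d <= e)%N -> polydeg d f -> polydeg e f.
Proof.
by move=> de [m [C [h [hP fE]]]]; exists m, C, h; split=> //; exact: affprod_le hP.
Qed.

Lemma polydegD n p d (f g : 'cV[K]_n -> 'cV[K]_p) :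
  polydeg d f -> polydeg d g -> polydeg d (fun x => f x + g x).
Proof.
move=> [m [C [h [hP fE]]]] [m' [C' [h' [hP' gE]]]].
exists (m + m')%N, (row_mx C C'), (fun x => col_mx (h x) (h' x)).
by split=> [|x]; [exact: affprod_col | rewrite mul_row_col fE gE].
Qed.

Lemma polydeg_mull n p q d (A : 'M[K]_(q, p)) (f : 'cV[K]_n -> 'cV[K]_p) :
  polydeg d f -> polydeg d (fun x => A *m f x).
Proof.
by move=> [m [C [h [hP fE]]]]; exists m, (A *m C), h; split=> // x; rewrite fE mulmxA.
Qed.

Lemma polydeg_col n p q d (f : 'cV[K]_n -> 'cV[K]_p) (g : 'cV[K]_n -> 'cV[K]_q) :
  polydeg d f -> polydeg d g -> polydeg d (fun x => col_mx (f x) (g x)).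
Proof.
move=> fP gP.
apply: eq_polydeg (polydegD (polydeg_mull (col_mx 1%:M 0) fP) (polydeg_mull (col_mx 0 1%:M) gP)) => x.
by rewrite !mul_col_mx !mul1mx !mul0mx add_col_mx addr0 add0r.
Qed.

Lemma polydeg_cst n p d (b : 'cV[K]_p) : polydeg d (fun _ : 'cV[K]_n => b).
Proof.
apply: (@polydeg_le _ _ 0) => //; exists 1, b, (fun _ => const_mx 1); split=> //= x.
by apply/colP => i; rewrite mxE big_ord1 mxE mulr1.
Qed.

Lemma polydeg_lin n p d (A : 'M[K]_(p, n)) : polydeg d.+1 (fun x => A *m x).
Proof.
apply: (@polydeg_le _ _ 1) => //; apply: affprod_polydeg; exists A, 0, (fun _ => const_mx 1).
by split=> //= x; rewrite had1r addr0.
Qed.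

Lemma polydeg_sum n p d (I : Type) (r : seq I) (f : I -> 'cV[K]_n -> 'cV[K]_p) :
  (forall i, polydeg d (f i)) -> polydeg d (fun x => \sum_(i <- r) f i x).
Proof.
move=> fP; elim: r => [|i r IH].
  by apply: eq_polydeg (polydeg_cst n d 0) => x; rewrite big_nil.
by apply: eq_polydeg (polydegD (fP i) IH) => x; rewrite big_cons.
Qed.

Lemma polydeg_mpoly n (p : {mpoly K[n]}) :
  exists d, polydeg d (fun x => (p.@[pt x])%:M : 'cV_1).
Proof.
have had_scalar a b : had a%:M b%:M = (a * b)%:M :> 'cV[K]_1.
  by apply/colP => i; rewrite !mxE !ord1.
have affX (m : 'X_{1..n}) : exists d, affprod d (fun x => ('X_[m].@[pt x])%:M : 'cV[K]_1).
  rewrite mpolyXE_id; elim/big_ind: _ => [|u v [d ud] [e ve]|i _].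
  - by exists 0%N => /= x; rewrite meval1; apply/colP => i; rewrite !mxE ord1.
  - exists (d + e)%N; apply: eq_affprod (affprod_had ud ve) => x.
    by rewrite mevalM had_scalar.
  exists (m i); elim: (m i) => [|k IHk].
    by move=> /= x; rewrite expr0 meval1; apply/colP => l; rewrite !mxE ord1.
  exists (delta_mx 0 i), 0, (fun x => (('X_i ^+ k).@[pt x])%:M); split=> // x.
  rewrite exprS mevalM addr0 -had_scalar mevalXU; congr (had _ _).
  by apply/colP => l; rewrite -rowE !mxE !ord1 mulr1n.
elim/mpolyind: p => [|c m p _ _ [d pd]].
  by exists 0%N; apply: eq_polydeg (polydeg_cst n 0 0) => x; rewrite meval0 raddf0.
have [e me] := affX m.
exists (d + e)%N.
apply: eq_polydeg (polydegD (polydeg_mull c%:M (polydeg_le (leq_addl d e) (affprod_polydeg me)))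
  (polydeg_le (leq_addr e d) pd)) => x.
by rewrite mevalD mevalZ raddfD -scalar_mxM.
Qed.

Lemma polydeg_polymap n (P : polyvec K n) : exists d, polydeg d (polymap P).
Proof.
have [d dP] := fin_all_exists (fun i => polydeg_mpoly (P i 0)).
exists (\sum_i d i)%N.
apply: (@eq_polydeg _ _ _ (fun x => \sum_i delta_mx i 0 *m ((P i 0).@[pt x])%:M)) => [x|].
  apply/colP => i; rewrite summxE (bigD1 i) //= big1 => [|j ji].
    by rewrite addr0 !mxE big_ord1 !mxE !eqxx mul1r mulr1n.
  by rewrite !mxE big_ord1 !mxE eq_sym (negbTE ji) mul0r.
apply: polydeg_sum => i; apply: polydeg_mull; apply: polydeg_le (dP i).
by rewrite (bigD1 i) //= leq_addr.
Qed.

(* With [f = C (a o b)], entrywise product [o], [a] of degree 2 and [b] of degree [d + 2],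
   [f' (x, y, z) = (f x - C ((y + a x) o (z + b x)), y + a x, z + b x)] is [f x id]
   composed with two shears, and its top terms [a o b] cancel. *)
Lemma degree_step d :
  (forall n (f : 'cV[K]_n -> 'cV[K]_n), polydeg d.+3 f -> kmap f -> injective f) ->
  forall n (f : 'cV[K]_n -> 'cV[K]_n), polydeg d.+4 f -> kmap f -> injective f.
Proof.
move=> IH n f [m [C [g [[A1 [b1 [l [[A2 [b2 [b [bP lE]]]] gE]]]] fE]]]] fK.
change (affprod d.+2 b) in bP.
pose a x := had (A1 *m x + b1) (A2 *m x + b2).
have aP : affprod 2 a.
  exists A1, b1, (fun x => A2 *m x + b2); split=> //.
  exists A2, b2, (fun=> const_mx 1); split=> // x; by rewrite had1r.
pose s x := col_mx (a x) (b x).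
pose t (w : 'cV[K]_(m + m)) := - C *m had (usubmx w) (dsubmx w).
pose f' (v : 'cV[K]_(n + (m + m))) :=
  let w := dsubmx v + s (usubmx v) in col_mx (f (usubmx v) + t w) w.
have f'K : kmap f'.
  have [Ja aJ] := affprod_hasjac aP; have [Jb bJ] := affprod_hasjac bP.
  have tJ := hasjac_mull (- C) (hasjac_had (@hasjac_usub K m m) (@hasjac_dsub K m m)).
  apply: eq_kmap (kmap_comp (kmap_ushear tJ)
    (kmap_comp (kmap_prod (m + m) fK) (kmap_dshear (hasjac_col aJ bJ)))) => v /=.
  by rewrite !(col_mxKu, col_mxKd).
have f'P : polydeg d.+3 f'.
  (* In the first block [had (a x) (b x)] cancels. There remain terms of degree 2, [d + 3] and 3;
     the last one, the product of [z] and [a x], is why this descent stops at degree three. *)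
  have E v : f' v = col_mx (- C *m (had (usubmx (dsubmx v)) (dsubmx (dsubmx v))
      + had (usubmx (dsubmx v)) (b (usubmx v)) + had (dsubmx (dsubmx v)) (a (usubmx v))))
    (dsubmx v + s (usubmx v)).
    rewrite /f' /=; congr col_mx; rewrite fE gE lE /t !linearD /= col_mxKu col_mxKd.
    rewrite hadA -/(a _) -[C *m _]opprK -mulNmx -!mulmxDr -mulmxN -mulmxDr; congr (_ *m _).
    by apply/colP => i; rewrite !mxE; ring.
  apply: eq_polydeg (fun v => esym (E v)) _.
  have linE k (A : 'M[K]_(k, n + (m + m))) e (h : 'cV[K]_(n + (m + m)) -> 'cV[K]_k) : (e <= d.+2)%N ->
      affprod e h -> polydeg d.+3 (fun v => had (A *m v) (h v)).
    by move=> ed hP; apply: affprod_polydeg; apply: (affprod_le (d := e.+1)) => //; exact: affprod_lin.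
  have uE (v : 'cV[K]_(n + (m + m))) : usubmx v = row_mx 1%:M 0 *m v by exact: usubmxE_mul.
  have yE (v : 'cV[K]_(n + (m + m))) :
    usubmx (dsubmx v) = (row_mx 1%:M 0 *m row_mx 0 1%:M) *m v.
    by rewrite usubmxE_mul dsubmxE_mul mulmxA.
  have zE (v : 'cV[K]_(n + (m + m))) :
    dsubmx (dsubmx v) = (row_mx 0 1%:M *m row_mx 0 1%:M) *m v.
    by rewrite [dsubmx (dsubmx v)]dsubmxE_mul dsubmxE_mul mulmxA.
  apply: polydeg_col.
    apply: polydeg_mull; apply: polydegD; first apply: polydegD.
    - apply: (eq_polydeg (f := fun v => had (row_mx 1%:M 0 *m row_mx 0 1%:M *m v)
        (had (row_mx 0 1%:M *m row_mx 0 1%:M *m v) (const_mx 1)))) => [v|].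
        by rewrite had1r -yE -zE.
      apply: linE (affprod_lin _ (d := 0) _) => // x.
    - apply: (eq_polydeg (f := fun v => had (row_mx 1%:M 0 *m row_mx 0 1%:M *m v)
        (b (row_mx 1%:M 0 *m v)))) => [v|].
        by rewrite -yE -uE.
      exact: linE (leqnn _) (affprod_comp _ bP).
    - apply: (eq_polydeg (f := fun v => had (row_mx 0 1%:M *m row_mx 0 1%:M *m v)
        (a (row_mx 1%:M 0 *m v)))) => [v|].
        by rewrite -zE -uE.
      exact: linE (affprod_comp _ aP).
  apply: polydegD.
    by apply: eq_polydeg (polydeg_lin _ (row_mx 0 1%:M)) => v; rewrite dsubmxE_mul.
  apply: (eq_polydeg (f := fun v => s (row_mx 1%:M 0 *m v))) => [v|]; first by rewrite -uE.
  apply: polydeg_col; apply: affprod_polydeg; first exact: affprod_le (affprod_comp _ aP).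
  exact: affprodS (affprod_comp _ bP).
move=> x1 x2 f12.
(* At [(x, - s x)] the second block of [f'] is 0 and the first is [f x + t 0], so a collision of [f]
   is one of [f']. *)
have : col_mx x1 (- s x1) = col_mx x2 (- s x2).
  apply: (IH _ _ f'P f'K); rewrite /f' !(col_mxKu, col_mxKd) !addNr f12 //.
by case/eq_col_mx.
Qed.

Lemma degree_reduction d :
  (forall n (f : 'cV[K]_n -> 'cV[K]_n), polydeg 3 f -> kmap f -> injective f) ->
  forall n (f : 'cV[K]_n -> 'cV[K]_n), polydeg d f -> kmap f -> injective f.
Proof.
move=> H n f fP.
have H' e : forall k (g : 'cV[K]_k -> 'cV[K]_k), polydeg e.+3 g -> kmap g -> injective g.
  by elim: e => // e IH k g; exact: degree_step.
by apply: (H' d); apply: polydeg_le fP; rewrite -addn3 leq_addr.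
Qed.

End Degree.

(** * From degree three to cubic linear maps *)

(** Sylvester's identity, from two block triangular factorizations of the same matrix [B]. It
    relates determinants of different sizes, hence Jacobians in different numbers of variables. *)
Lemma det_1addmx_comm (R : comNzRingType) m n (U : 'M[R]_(m, n)) (V : 'M[R]_(n, m)) :
  \det (1%:M + U *m V) = \det (1%:M + V *m U).
Proof.
pose B := block_mx 1%:M (- U) V 1%:M.
have BV : B = block_mx 1%:M 0 V 1%:M *m block_mx 1%:M (- U) 0 (1%:M + V *m U).
  rewrite mulmx_block !(mul1mx, mul0mx, mulmx1, addr0).
  by rewrite mulmxN addrCA addNr addr0.
have BU : B = block_mx 1%:M (- U) 0 1%:M *m block_mx (1%:M + U *m V) 0 V 1%:M.
  rewrite mulmx_block !(mul1mx, mul0mx, mulmx1, add0r).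
  by rewrite mulNmx addrK.
have := congr1 determinant BV; rewrite BU !det_mulmx !det_ublock !det_lblock.
by rewrite !det1 !mul1r !mulr1.
Qed.

Section Cubic.
Variable K : numFieldType.

Lemma had_diag m (u v : 'cV[K]_m) : had u v = diag_mx u^T *m v.
Proof. by apply/colP => i; rewrite mul_diag_mx !mxE. Qed.

Lemma cubeE m (v : 'cV[K]_m) : cube v = had v (had v v).
Proof. by apply/colP => i; rewrite !mxE; ring. Qed.

Lemma hasjac_cube n m (f : 'cV[K]_n -> 'cV[K]_m) J : hasjac f J ->
  hasjac (fun x => cube (f x)) (fun x => diag_mx (\row_i (3 * f x i 0 ^+ 2)) *m J x).
Proof.
move=> fJ; apply: eq_hasjac (hasjac_had fJ (hasjac_had fJ fJ)) => x.
  by rewrite cubeE.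
by apply/matrixP => i k; rewrite mul_diag_mx !mxE; ring.
Qed.

Hypothesis dmap_injective :
  forall n, (2 <= n)%N -> forall P : polyvec K n, dmap P -> injective (polymap P).

(* The map [y |-> y + (ACy)^{*3}] is semi-conjugate, through [C], to
   [x |-> x + C(Ax)^{*3}]; as [C] is onto and translations by [ker C] commute
   with the former, a collision of the latter lifts. *)
Lemma onto_cubic_injective n m (C : 'M[K]_(n, m)) (A : 'M[K]_(m, n)) (C' : 'M[K]_(m, n)) :
  (2 <= m)%N -> C *m C' = 1%:M ->
  kmap (fun x => x + C *m cube (A *m x)) -> injective (fun x => x + C *m cube (A *m x)).
Proof.
move=> m2 CC' [J [c [fJ c0 dJ]]].
pose D y := y + cube (A *m C *m y).
pose P : polyvec K m := Xvec K m + cube (map_mx (@mpolyC m K) (A *m C) *m Xvec K m).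
have PD : polymap P =1 D.
  move=> y; apply/colP => i; rewrite !mxE mevalD mevalXU rmorphXn /=; congr (_ + _ ^+ 3).
  rewrite raddf_sum; apply: eq_bigr => j _ /=.
  by rewrite !mxE mevalM mevalC mevalXU.
have DJ := hasjacD (@hasjac_id K m) (hasjac_cube (hasjac_lin (A *m C))).
have JE := hasjac_unique fJ (hasjacD (@hasjac_id K n) (hasjac_mull C (hasjac_cube (hasjac_lin A)))).
have Dinj : injective D.
  apply: (eq_inj _ PD); apply: dmap_injective m2 _ _; split; last by exists (A *m C).
  apply/keller_kmap; apply: eq_kmap (fun x => esym (PD x)) _.
  eexists; exists c; split; [exact: DJ | exact: c0 | move=> y].
  (* By Sylvester's identity, the Jacobian determinant of [D] at [y] is that of the original map at
     [C *m y]. *)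
  by rewrite /= mulmxA det_1addmx_comm mulmxA -(dJ (C *m y)) JE !mulmxA.
move=> x1 x2 f12.
pose k := D (C' *m x1) - D (C' *m x2).
have CD x : C *m D (C' *m x) = x + C *m cube (A *m x).
  by rewrite /D mulmxDr !mulmxA CC' mul1mx -(mulmxA A) CC' mulmx1.
have Ck : C *m k = 0 by rewrite mulmxBr !CD f12 subrr.
have : C' *m x1 = C' *m x2 + k.
  apply: Dinj; rewrite {2}/D mulmxDr -(mulmxA A C k) Ck mulmx0 addr0 addrAC -/(D _).
  by rewrite addrC subrK.
by move/(congr1 (mulmx C)); rewrite mulmxDr Ck addr0 !mulmxA CC' !mul1mx.
Qed.

(** Appending an identity block to [C] and zero rows to [A] leaves the map unchanged and makes the
    matrix onto; the new number of columns is at least [n], hence at least 2. *)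
Lemma cubic_injective n m (C : 'M[K]_(n, m)) (A : 'M[K]_(m, n)) :
  (2 <= n)%N -> kmap (fun x => x + C *m cube (A *m x)) ->
  injective (fun x => x + C *m cube (A *m x)).
Proof.
move=> n2.
have E x : x + row_mx C 1%:M *m cube (col_mx A 0 *m x) = x + C *m cube (A *m x).
  rewrite /cube mul_col_mx map_col_mx mul_row_col mul0mx mul1mx.
  suff -> : map_mx (fun v : K => v ^+ 3) 0 = 0 :> 'cV_n by rewrite addr0.
  by apply/matrixP => i j; rewrite !mxE expr0n.
move=> fK; apply: (eq_inj _ E).
apply: (@onto_cubic_injective _ _ _ _ (col_mx 0 1%:M)); first exact: leq_trans (leq_addl _ _).
  by rewrite mul_row_col mulmx0 mulmx1 add0r.
by apply: eq_kmap fK => x; rewrite E.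
Qed.

Definition cubform n p (h : 'cV[K]_n -> 'cV[K]_p) :=
  exists m (C : 'M_(p, m)) (A : 'M_(m, n)), forall x, h x = C *m cube (A *m x).

Lemma cubformD n p (f g : 'cV[K]_n -> 'cV[K]_p) :
  cubform f -> cubform g -> cubform (fun x => f x + g x).
Proof.
move=> [m [C [A fE]]] [m' [C' [A' gE]]].
exists (m + m')%N, (row_mx C C'), (col_mx A A') => x.
by rewrite fE gE /cube mul_col_mx map_col_mx mul_row_col.
Qed.

Lemma cubform_mull n p q (M : 'M[K]_(q, p)) (f : 'cV[K]_n -> 'cV[K]_p) :
  cubform f -> cubform (fun x => M *m f x).
Proof. by move=> [m [C [A fE]]]; exists m, (M *m C), A => x; rewrite fE mulmxA. Qed.

Lemma eq_cubform n p (f g : 'cV[K]_n -> 'cV[K]_p) : f =1 g -> cubform f -> cubform g.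
Proof. by move=> fg [m [C [A fE]]]; exists m, C, A => x; rewrite -fg. Qed.

(** Polarization: [24abc = (a+b+c)^3 + (a-b-c)^3 - (a+b-c)^3 - (a-b+c)^3]. *)
Lemma cubform_had n p (A B C : 'M[K]_(p, n)) :
  cubform (fun x => had (A *m x) (had (B *m x) (C *m x))).
Proof.
have cubP (L : 'M[K]_(p, n)) : cubform (fun x => cube (L *m x)).
  by exists p, 1%:M, L => x; rewrite mul1mx.
have := cubform_mull (24%:R^-1)%:M (cubformD (cubformD (cubP (A + B + C)) (cubP (A - B - C)))
   (cubform_mull (-1)%:M (cubformD (cubP (A + B - C)) (cubP (A - B + C))))).
apply: eq_cubform => x; apply/colP => i.
rewrite !mulmxDl !mul_scalar_mx !mulNmx !mxE.
by field.
Qed.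

(* With [f = x + F2 + F3], the cubic map [(x, y, t) |-> (x + t F2 x - t^2 y, y + F3 x, t)]
   is [(x + t F2 x + t^2 F3 x, y, t)] composed with two shears; for [t != 0] the latter is
   [f] conjugated by a homothety. *)
Lemma normalized_deg3_injective n (f : 'cV[K]_n -> 'cV[K]_n) J c : (0 < n)%N ->
  polydeg 3 f -> f 0 = 0 -> hasjac f J -> J 0 = 1%:M -> (forall x, \det (J x) = c) ->
  injective f.
Proof.
move=> n0 [m [C [g [[A1 [b1 [l1 [[A2 [b2 [l2 [[A3 [b3 [l3 [l3E l2E]]]] l1E]]]] gE]]]] fE]]]].
move=> f0 fJ J0 dJ.
have {}fE x : f x = C *m had (A1 *m x + b1) (had (A2 *m x + b2) (A3 *m x + b3)).
  by rewrite fE gE l1E l2E l3E had1r.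
(* Expansion by degree of the product of three affine maps. [M] collects the linear terms; [B1]
   gathers the two quadratic terms containing [A3 x], and [B2] serves the remaining one, with
   coefficient [b3]. *)
pose dg (b : 'cV[K]_m) := diag_mx b^T.
pose M := C *m (dg (had b2 b3) *m A1 + dg (had b1 b3) *m A2 + dg (had b1 b2) *m A3).
pose B1 := dg b1 *m A2 + dg b2 *m A1.
pose B2 := dg b3 *m A1.
pose F2 x := C *m (had (B1 *m x) (A3 *m x) + had (B2 *m x) (A2 *m x)).
pose F3 x := C *m had (A1 *m x) (had (A2 *m x) (A3 *m x)).
have {}fE x : f x = M *m x + F2 x + F3 x.
  have C0 : C *m had b1 (had b2 b3) = 0.
    by rewrite -f0 fE !mulmx0 !add0r.
  rewrite fE /M /F2 /F3 -[RHS]add0r -C0 -!mulmxA -!mulmxDr; congr (_ *m _).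
  rewrite !mulmxDl -!mulmxA -!had_diag.
  by apply/colP => i; rewrite !mxE; ring.
have hadJ k (L L' : 'M[K]_(k, n)) := hasjac_had (hasjac_lin L) (hasjac_lin L').
have F2J := hasjac_mull C (hasjacD (hadJ _ B1 A3) (hadJ _ B2 A2)).
have F3J := hasjac_mull C (hasjac_had (hasjac_lin A1) (hadJ _ A2 A3)).
have M1 : M = 1%:M.
  have fJ' := hasjacD (hasjacD (hasjac_lin M) F2J) F3J.
  have := hasjac_unique fJ (eq_hasjac (fun x => esym (fE x)) (frefl _) fJ') 0.
  rewrite J0 !mulmx0 => ->; rewrite -[LHS]addr0 -[LHS]addr0; congr (_ + _ + _).
    by apply/esym; rewrite -[RHS](mulmx0 _ C); congr (_ *m _); apply/matrixP => i j; rewrite !mxE; ring.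
  by apply/esym; rewrite -[RHS](mulmx0 _ C); congr (_ *m _); apply/matrixP => i j; rewrite !mxE; ring.
have {}fE x : f x = x + F2 x + F3 x by rewrite fE M1 mul1mx.
(* The map [h] is the identity in [x] on the fibre [t = 0], so its determinant can be constant in
   [t] only if that of [f] is 1. *)
have c1 : c = 1 by rewrite -(dJ 0) J0 det1.
have hadZ k a b (u v : 'cV[K]_k) : had (a *: u) (b *: v) = (a * b) *: had u v.
  by apply/colP => i; rewrite !mxE mulrACA.
have F2Z t x : F2 (t *: x) = t ^+ 2 *: F2 x.
  by rewrite /F2 -!scalemxAr !hadZ -scalerDr -scalemxAr.
have F3Z t x : F3 (t *: x) = t ^+ 3 *: F3 x.
  by rewrite /F3 -!scalemxAr !hadZ -scalemxAr.
pose X : 'M[K]_(n, n + (n + 1)) := row_mx 1%:M 0.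
pose tau (w : 'cV[K]_(n + 1)) := dsubmx w 0 0.
pose T k : 'M[K]_(k, n + 1) := const_mx 1 *m row_mx 0 1%:M.
have TE k w : T k *m w = const_mx (tau w).
  by rewrite /T -mulmxA -dsubmxE_mul /tau; apply/colP => i; rewrite !mxE big_ord1 !mxE mul1r.
have had_const k a (v : 'cV[K]_k) : had (const_mx a) v = a *: v.
  by apply/colP => i; rewrite !mxE.
pose s x : 'cV[K]_(n + 1) := col_mx (F3 x) 0.
pose r (w : 'cV[K]_(n + 1)) := - (tau w ^+ 2 *: usubmx w).
pose h (v : 'cV[K]_(n + (n + 1))) := let x := usubmx v in let t := tau (dsubmx v) in
   x + t *: F2 x + t ^+ 2 *: F3 x.
have [Jh hJ] : exists Jh, hasjac h Jh.
  have uJ := @hasjac_usub K n (n + 1); have wJ := @hasjac_dsub K n (n + 1).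
  have tJ := hasjac_comp (hasjac_lin (T n)) wJ.
  have := hasjacD (hasjacD uJ (hasjac_had tJ (hasjac_comp F2J uJ)))
    (hasjac_had tJ (hasjac_had tJ (hasjac_comp F3J uJ))).
  move=> H; eexists; apply: eq_hasjac H => // v /=.
  by rewrite !TE !had_const scalerA -expr2.
have hK : kmap (fun v => col_mx (h v) (dsubmx v)).
  apply: (kmap_block hJ (oner_neq0 K)) => v.
  pose t := tau (dsubmx v).
  have gJ := hasjac_comp hJ (hasjacD (hasjac_lin (col_mx 1%:M 0))
    (hasjac_cst n (col_mx 0 (dsubmx v)))).
  have hE x : h (col_mx 1%:M 0 *m x + col_mx 0 (dsubmx v)) = x + t *: F2 x + t ^+ 2 *: F3 x.
    by rewrite mul_col_mx add_col_mx mul1mx mul0mx addr0 add0r /h col_mxKu col_mxKd.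
  have vE : col_mx 1%:M 0 *m usubmx v + col_mx 0 (dsubmx v) = v.
    by rewrite mul_col_mx add_col_mx mul1mx mul0mx addr0 add0r vsubmxK.
  have {}gJ : hasjac (fun x => x + t *: F2 x + t ^+ 2 *: F3 x) (fun x => lsubmx (Jh (col_mx 1%:M 0 *m x + col_mx 0 (dsubmx v)))).
    apply: eq_hasjac gJ => x; first exact: hE.
    by rewrite addr0 -[X in X *m _]hsubmxK mul_row_col mulmx1 mulmx0 addr0.
  have [t0|t_neq0] := eqVneq t 0.
    have := hasjac_unique gJ (eq_hasjac _ (frefl _) (@hasjac_id K n)) (usubmx v).
    rewrite vE => ->; first exact: det1.
    by move=> x; rewrite t0 expr0n !scale0r !addr0.
  have := hasjac_unique gJ (eq_hasjac _ (frefl _)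
     (hasjac_mull t^-1%:M (hasjac_comp fJ (hasjac_lin t%:M)))) (usubmx v).
  rewrite vE => ->.
    rewrite !det_mulmx !det_scalar mulrCA -exprMn mulVf // expr1n mulr1 dJ; exact: c1.
  move=> x; rewrite /= fE !mul_scalar_mx F2Z F3Z !scalerDr !scalerA mulVf // scale1r.
  by rewrite !exprS expr0 mulr1 !mulKf.
pose H (v : 'cV[K]_(n + (n + 1))) := col_mx (tau (dsubmx v) *: F2 (usubmx v) + r (dsubmx v)) (s (usubmx v)).
have HC : cubform H.
  pose W : 'M[K]_(n + 1, n + (n + 1)) := row_mx 0 1%:M.
  have XE v : X *m v = usubmx v by rewrite usubmxE_mul.
  have WE v : W *m v = dsubmx v by rewrite dsubmxE_mul.
  apply: eq_cubform (cubformD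
    (cubform_mull (col_mx 1%:M 0) (cubformD
      (cubform_mull C (cubformD (cubform_had (T m *m W) (B1 *m X) (A3 *m X))
                                (cubform_had (T m *m W) (B2 *m X) (A2 *m X))))
      (cubform_mull (-1)%:M (cubform_had (T n *m W) (T n *m W) (row_mx 1%:M 0 *m W)))))
    (cubform_mull (col_mx 0 1%:M) (cubform_mull (col_mx 1%:M 0) (cubform_mull C
      (cubform_had (A1 *m X) (A2 *m X) (A3 *m X)))))) => v.
  rewrite -!(mulmxA _ X) -!(mulmxA _ W) !XE !WE !TE !had_const -usubmxE_mul.
  rewrite -scalerDr -scalemxAr scalerA mul_scalar_mx scaleN1r -expr2.
  by rewrite !mul_col_mx !mul1mx !mul0mx !add_col_mx addr0 add0r.
pose G v := v + H v.
have GK : kmap G.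
  have tJ := hasjac_lin (T n).
  have rJ := hasjac_mull (-1)%:M (hasjac_had tJ (hasjac_had tJ (@hasjac_usub K n 1))).
  have sJ := hasjac_col F3J (hasjac_cst n (0 : 'cV[K]_1)).
  apply: eq_kmap (kmap_comp (kmap_ushear rJ) (kmap_comp hK (kmap_dshear sJ))) => v /=.
  rewrite !(col_mxKu, col_mxKd) !TE !had_const scalerA -expr2 mul_scalar_mx scaleN1r.
  rewrite /h !(col_mxKu, col_mxKd) -/(F3 _) -/(s _).
  have tauE : tau (dsubmx v + s (usubmx v)) = tau (dsubmx v).
    by rewrite /tau linearD /= col_mxKd addr0.
  rewrite tauE linearD /= col_mxKu scalerDr /G /H -[X in _ = X + _]vsubmxK add_col_mx; congr col_mx.
  by rewrite /r opprD addrACA subrr addr0 addrA.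
(* On the slice [t = 1], [y = - F3 x], the middle block cancels and the first one is [f x]; this
   carries collisions of [f] over to [G]. *)
have GE x : G (col_mx x (col_mx (- F3 x) 1%:M)) = col_mx (f x) (col_mx 0 1%:M).
  rewrite /G /H !(col_mxKu, col_mxKd) !add_col_mx addNr addr0 /r /tau col_mxKu col_mxKd.
  by rewrite mxE expr1n !scale1r opprK addrA fE.
have Ginj : injective G.
  have [k [C' [A' HE]]] := HC.
  have vH v : v + C' *m cube (A' *m v) = G v by rewrite /G HE.
  apply: (eq_inj _ vH); apply: cubic_injective; last first.
    by apply: eq_kmap GK => v; rewrite vH.
  by rewrite addn1 addnS ltnS addn_gt0 n0.
move=> x1 x2 f12.
have : col_mx x1 (col_mx (- F3 x1) 1%:M) = col_mx x2 (col_mx (- F3 x2) 1%:M).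
  by apply: Ginj; rewrite !GE f12.
by case/eq_col_mx.
Qed.

Lemma deg3_injective n (f : 'cV[K]_n -> 'cV[K]_n) :
  polydeg 3 f -> kmap f -> injective f.
Proof.
case: n f => [|n] f fP [J [c [fJ c0 dJ]]]; first by move=> x y _; apply/colP => -[].
have Ju : J 0 \in unitmx by rewrite unitmxE dJ unitfE.
pose g x := invmx (J 0) *m (f x + - f 0).
have gJ := hasjac_mull (invmx (J 0)) (hasjacD fJ (hasjac_cst n.+1 (- f 0))).
have ginj : injective g.
  apply: (normalized_deg3_injective (c := \det (invmx (J 0)) * c) _ _ _ gJ) => //.
  - exact: polydeg_mull (polydegD fP (polydeg_cst _ _ _)).
  - by rewrite /g subrr mulmx0.
  - by rewrite addr0 mulVmx.
  - by move=> x; rewrite addr0 det_mulmx dJ.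
by move=> x1 x2 f12; apply: ginj; rewrite /g f12.
Qed.

Lemma kmap_injective n (f : 'cV[K]_n -> 'cV[K]_n) : kmap f -> injective f.
Proof.
move=> fK; have [J [_ [fJ _ _]]] := fK; have [p pE] := fin_all_exists fJ.
have [d fd] := polydeg_polymap (\col_i p i).
apply: (degree_reduction deg3_injective (d := d)) => //.
by apply: eq_polydeg fd => x; apply/colP => i; have [-> _] := pE i; rewrite !mxE.
Qed.

End Cubic.

(** * Complex maps as real maps *)

Section Realification.
Variable R : rcfType.
Notation C := (complex R).
Notation toC := (real_complex R).
Notation I := (Complex 0 1 : C).

Definition cplx n (x : 'cV[R]_(n + n)) : 'cV[C]_n :=
  \col_i (Complex (x (lshift n i) 0) (x (rshift n i) 0)).

(* The two expressions of [p^`M(k)] are the Cauchy-Riemann equations. *)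
Lemma mpoly_real_parts n (p : {mpoly C[n]}) : exists u v : {mpoly R[n + n]},
  (forall x, p.@[pt (cplx x)] = Complex u.@[pt x] v.@[pt x]) /\
  (forall x k,
    p^`M(k).@[pt (cplx x)] = Complex u^`M(lshift n k).@[pt x] v^`M(lshift n k).@[pt x] /\
    p^`M(k).@[pt (cplx x)] = Complex v^`M(rshift n k).@[pt x] (- u^`M(rshift n k).@[pt x])).
Proof.
elim/mpoly_ring_ind: p => [[a b]|i|p q [u [v [pE dE]]] [u' [v' [qE dE']]]|
    p q [u [v [pE dE]]] [u' [v' [qE dE']]]].
- exists a%:MP, b%:MP; split=> [x|x k]; first by rewrite !mevalC.
  by rewrite !mderivC !meval0 oppr0.
- exists 'X_(lshift n i), 'X_(rshift n i); split=> [x|x k].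
    by rewrite !mevalXU /pt mxE.
  rewrite !mderiv_var !(inj_eq (@lshift_inj _ _)) !(inj_eq (@rshift_inj _ _)).
  rewrite eq_lrshift eq_rlshift meval0 oppr0.
  by case: (i == k); rewrite !(meval0, meval1).
- exists (u + u'), (v + v'); split=> [x|x k]; first by rewrite !mevalD pE qE.
  have [E1 E2] := dE x k; have [E1' E2'] := dE' x k.
  by rewrite !mderivD !mevalD; split; [rewrite E1 E1' | rewrite E2 E2' opprD].
- exists (u * u' - v * v'), (u * v' + v * u'); split=> [x|x k].
    by rewrite !(mevalD, mevalN, mevalM) pE qE.
  have [E1 E2] := dE x k; have [E1' E2'] := dE' x k.
  rewrite !(mderivD, mderivN, mderivM) !(mevalD, mevalN, mevalM) pE qE.
  by split; [rewrite E1 E1' | rewrite E2 E2']; apply/eqP; rewrite eq_complex /=;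
     apply/andP; split; apply/eqP; ring.
Qed.

Definition realify_mx n (Z : 'M[C]_n) : 'M[R]_(n + n) :=
  block_mx (map_mx (@complex.Re R) Z) (- map_mx (@complex.Im R) Z) (map_mx (@complex.Im R) Z) (map_mx (@complex.Re R) Z).

(** The two column blocks of [S] span the eigenspaces of the complex structure, so conjugation by
    [S] turns [realify_mx Z] into the diagonal blocks [Z] and its conjugate. The determinant of [S]
    is a power of [I + I]. *)
Lemma det_realify n (Z : 'M[C]_n) : toC (\det (realify_mx Z)) = \det Z * conjc (\det Z).
Proof.
pose S : 'M[C]_(n + n) := block_mx 1%:M 1%:M (- I)%:M I%:M.
have S0 : \det S != 0.
  have -> : S = block_mx 1%:M 0 (- I)%:M 1%:M *m block_mx 1%:M 1%:M 0 (I + I)%:M.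
    rewrite mulmx_block !(mul1mx, mul0mx, mulmx1, mulmx0, addr0) -raddfD /=.
    by rewrite addKr.
  rewrite det_mulmx det_lblock det_ublock !det1 !mul1r det_scalar expf_neq0 //.
  by rewrite eq_complex /= addr0 eqxx /= -[1 + 1]/(2%:R) pnatr_eq0.
suff /(congr1 determinant) :
    map_mx toC (realify_mx Z) *m S = S *m block_mx Z 0 0 (map_mx conjc Z).
  rewrite !det_mulmx det_map_mx det_ublock det_map_mx mulrC => /(mulfI S0) //.
rewrite /realify_mx map_block_mx !mulmx_block !(mul1mx, mul0mx, mulmx1, mulmx0, addr0, add0r).
rewrite !mul_mx_scalar !mul_scalar_mx; congr block_mx; apply/matrixP => i j; rewrite !mxE;
  case: (Z i j) => a b; apply/eqP; rewrite eq_complex /=;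
  apply/andP; split; apply/eqP; ring.
Qed.

Definition realmap n (P : polyvec C n) (x : 'cV[R]_(n + n)) : 'cV[R]_(n + n) :=
  let y := polymap P (cplx x) in col_mx (map_mx (@complex.Re R) y) (map_mx (@complex.Im R) y).

Lemma realmap_kmap n (P : polyvec C n) : keller P -> kmap (realmap P).
Proof.
move=> [c c0 Pc].
exists (fun x => realify_mx (map_mx (meval (pt (cplx x))) (jacobian P))), (complex.Re (c * conjc c)).
split=> [i||x].
- case: (split_ordP i) => j ->; have [u [v [PE dE]]] := mpoly_real_parts (P j 0).
    exists u; split=> [x|x k].
      by rewrite col_mxEu !mxE -/(pt _) PE.
    rewrite /realify_mx block_mxEh; case: (split_ordP k) => l ->; have [E1 E2] := dE x l.
      by rewrite row_mxEl col_mxEu !mxE E1.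
    by rewrite row_mxEr col_mxEu !mxE E2 /= opprK.
  exists v; split=> [x|x k].
    by rewrite col_mxEd !mxE -/(pt _) PE.
  rewrite /realify_mx block_mxEh; case: (split_ordP k) => l ->; have [E1 E2] := dE x l.
    by rewrite row_mxEl col_mxEd !mxE E1.
  by rewrite row_mxEr col_mxEd !mxE E2.
- have : c * conjc c != 0 by rewrite mulf_neq0 // conjc_eq0.
  apply: contraNneq => r0; rewrite eq_complex r0 eqxx /=.
  by case: (c) => a b /=; rewrite mulrN mulrC addNr.
by apply: (@complexI R); rewrite det_realify det_map_mx Pc /= mevalC; case: (c) => a b;
  apply/eqP; rewrite eq_complex /= eqxx mulrN mulrC addNr eqxx.
Qed.

Lemma realmap_injective n (P : polyvec C n) :
  injective (realmap P) -> injective (polymap P).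
Proof.
move=> rinj z w zw.
pose r (y : 'cV[C]_n) := col_mx (map_mx (@complex.Re R) y) (map_mx (@complex.Im R) y).
have rK y : cplx (r y) = y.
  by apply/colP => i; rewrite [LHS]mxE col_mxEu col_mxEd !mxE; case: (y i 0).
by rewrite -(rK z) -(rK w); congr cplx; apply: rinj; rewrite /realmap !rK zw.
Qed.

End Realification.

(** * Weak Nullstellensatz over an uncountable field *)

Definition ideal (A : comNzRingType) (I : A -> Prop) :=
  [/\ I 0, forall f g, I f -> I g -> I (f + g) & forall f g, I g -> I (f * g)].

Lemma ideal_sum (A : comNzRingType) (I : A -> Prop) (T : Type) (r : seq T) (P : pred T)
    (F : T -> A) :
  ideal I -> (forall i, I (F i)) -> I (\sum_(i <- r | P i) F i).
Proof. by move=> [I0 ID IM] FI; elim/big_rec: _ => // i x _; exact: ID. Qed.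

Section Nullstellensatz.
Variable K : closedFieldType.
(** What the uncountability of the field yields by pigeonhole, in the finitary form suited to a
    dimension count. *)
Hypothesis large_fiber : forall d : K -> nat, exists k, forall N, exists s : seq K,
  [/\ uniq s, size s = N & {in s, forall x, d x = k}].
Variable n : nat.
Implicit Types (I J : {mpoly K[n]} -> Prop) (f g h : {mpoly K[n]}).

Definition ideal_adjoin I a f := exists g h, I g /\ f = g + h * a.

Lemma ideal_adjoinP I a : ideal I -> ideal (ideal_adjoin I a).
Proof.
move=> [I0 ID IM]; split.
- by exists 0, 0; split=> //; rewrite mul0r addr0.
- move=> _ _ [g [h [Ig ->]]] [g' [h' [Ig' ->]]].
  by exists (g + g'), (h + h'); split; [exact: ID | rewrite mulrDl addrACA].
- move=> f _ [g [h [Ig ->]]]; exists (f * g), (f * h).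
  by split; [exact: IM | rewrite mulrDr mulrA].
Qed.

(** Over the algebraically closed [K], [q] is a product of linear factors; each of them is
    invertible modulo [I] and can be cancelled. *)
Lemma ideal_split_univariate I i (q : {poly K}) : ideal I -> q != 0 ->
  I (map_poly (@mpolyC n K) q).['X_i] ->
  (forall c, exists h, I (1 - h * ('X_i - c%:MP))) -> I 1.
Proof.
move=> [I0 ID IM] q0 Iq hP.
have [r qE] := closed_field_poly_normal q.
have {Iq} : I (\prod_(z <- r) ('X_i - z%:MP)).
  have := IM (lead_coef q)^-1%:MP _ Iq.
  rewrite {2}qE map_polyZ hornerZ /= mulrA -mpolyCM mulVf ?lead_coef_eq0 // mpolyC1 mul1r.
  rewrite rmorph_prod /= horner_prod; congr (I _); apply: eq_bigr => z _.
  by rewrite rmorphB /= map_polyX map_polyC hornerXsubC.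
elim: r {qE} => [|z r IH]; first by rewrite big_nil.
rewrite big_cons => Iz; apply: IH.
have [h Ih] := hP z; set g := \prod_(_ <- _) _ in Iz *.
have -> : g = g * (1 - h * ('X_i - z%:MP)) + h * (('X_i - z%:MP) * g) by ring.
by apply: ID; exact: IM.
Qed.

(* If [1 = h_c (X_i - c)] modulo [I] for every [c], then infinitely many of the
   [h_c] lie in the same finite-dimensional space; clearing denominators in a linear
   relation between these "inverses of [X_i - c]" yields a univariate element of [I]. *)
Lemma ideal_adjoin_proper I i : ideal I -> ~ I 1 ->
  exists c, ~ ideal_adjoin I ('X_i - c%:MP) 1.
Proof.
move=> II I1; have [I0 ID IM] := II; apply: contrapT => noc; apply: I1.
have hP c : exists h, I (1 - h * ('X_i - c%:MP)).
  have [g [h [Ig E]]] : ideal_adjoin I ('X_i - c%:MP) 1.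
    by apply: contrapT => nc; apply: noc; exists c.
  by exists h; rewrite E addrK.
have [h hE] := choice hP.
have [k kP] := large_fiber (fun c => msize (h c)).
pose D := #|{: 'X_{1..n < k}}|.
have [s [s_uniq s_size sk]] := kP D.+1.
pose c (j : 'I_D.+1) := s`_j.
have cs j : c j \in s by rewrite mem_nth // s_size.
have c_inj : injective c.
  by move=> j l /eqP; rewrite nth_uniq ?s_size // => /eqP /val_inj.
pose A : 'M[K]_(D.+1, D) := \matrix_(j, l) (h (c j))@_(enum_val l : 'X_{1..n < k}).
have : kermx A != 0.
  rewrite -mxrank_eq0 mxrank_ker subn_eq0 -ltnNge.
  exact: leq_ltn_trans (rank_leq_col A) _.
case/rowV0Pn => a /sub_kermxP aA a0.
have [j0 aj0] : exists j, a 0 j != 0 by apply/rV0Pn.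
have ah : \sum_j a 0 j *: h (c j) = 0.
  apply/mpolyP => m; rewrite raddf_sum mcoeff0 /=.
  have [mk|km] := ltnP (mdeg m) k; last first.
    rewrite big1 // => j _; rewrite mcoeffZ memN_msupp_eq0 ?mulr0 //.
    by apply: msize_mdeg_ge; rewrite sk.
  pose b := BMultinom mk.
  have := congr1 (fun B : 'M_(1, D) => B 0 (enum_rank b)) aA.
  rewrite !mxE => E; apply: etrans E; apply: eq_bigr => j _.
  by rewrite mxE enum_rankK mcoeffZ.
pose pr (j : 'I_D.+1) : {poly K} := \prod_(l | l != j) ('X - (c l)%:P).
pose q := \sum_j a 0 j *: pr j.
have prX j : (map_poly (@mpolyC n K) (pr j)).['X_i] = \prod_(l | l != j) ('X_i - (c l)%:MP).
  rewrite rmorph_prod /= horner_prod; apply: eq_bigr => l _.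
  by rewrite rmorphB /= map_polyX map_polyC hornerXsubC.
apply: (@ideal_split_univariate I i q) => //.
  (* At [c j0] every summand of [q] vanishes except the one of index [j0], whose product is nonzero
     there because the [c j] are distinct. *)
  apply: contraNneq aj0 => q0.
  have := congr1 (fun p : {poly K} => p.[c j0]) q0.
  rewrite /= horner_sum horner0 (bigD1 j0) //= big1 => [|j jj0].
    rewrite addr0 hornerZ => /eqP; rewrite mulf_eq0 => /orP[//|].
    rewrite horner_prod => /eqP /eqP /prodf_eq0 [l lj0].
    by rewrite hornerXsubC subr_eq0 (inj_eq c_inj) eq_sym (negbTE lj0).
  rewrite hornerZ horner_prod (bigD1 j0) /=; last by rewrite eq_sym.
  by rewrite hornerXsubC subrr mul0r mulr0.
pose X j := \prod_(l | l != j) ('X_i - (c l)%:MP) : {mpoly K[n]}.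
(* The terms containing [h (c j)] add up to the product of all ['X_i - c l] times the linear
   relation [ah], that is, to zero. *)
have -> : (map_poly (@mpolyC n K) q).['X_i] =
   \sum_j ((a 0 j)%:MP * X j) * (1 - h (c j) * ('X_i - (c j)%:MP)).
  transitivity (\sum_j (a 0 j)%:MP * X j).
    rewrite rmorph_sum /= horner_sum; apply: eq_bigr => j _.
    by rewrite map_polyZ hornerZ prX.
  under [RHS]eq_bigr => j _ do rewrite mulrBr mulr1.
  rewrite sumrB -[LHS]subr0; congr (_ - _); apply/esym.
  have := congr1 ( *%R (\prod_l ('X_i - (c l)%:MP))) ah.
  rewrite mulr0 mulr_sumr => E; apply: etrans E; apply: eq_bigr => j _; rewrite [in RHS](bigD1 j) //= -/(X j) -mul_mpolyC.
  by ring.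
by apply: ideal_sum => // j; exact: IM.
Qed.

(** Adjoining some ['X_i - c] for each variable in turn keeps the ideal proper. Modulo the resulting
    ideal every polynomial equals its value at [x], so a member with nonzero value would make 1 a
    member. *)
Theorem weak_nullstellensatz I : ideal I -> ~ I 1 ->
  exists x : 'I_n -> K, forall f, I f -> f.@[x] = 0.
Proof.
move=> II I1.
have : forall r : seq 'I_n, exists J, [/\ ideal J, ~ J 1, forall f, I f -> J f &
    {in r, forall i, exists c, J ('X_i - c%:MP)}].
  elim=> [|i r [J [JI J1 IJ Jr]]]; first by exists I; split.
  have [c Jc] := ideal_adjoin_proper i JI J1.
  have JJ f : J f -> ideal_adjoin J ('X_i - c%:MP) f.
    by move=> Jf; exists f, 0; split=> //; rewrite mul0r addr0.
  exists (ideal_adjoin J ('X_i - c%:MP)); split=> //.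
  - exact: ideal_adjoinP.
  - by move=> f /IJ /JJ.
  move=> l; rewrite inE => /orP[/eqP ->|/Jr [b /JJ]]; last by exists b.
  by exists c, 0, 1; split; [case: JI | rewrite add0r mul1r].
move=> /(_ (enum 'I_n)) [J [[J0 JD JM] J1 IJ Jr]].
have [x xP] := choice (fun i => Jr i (mem_enum _ i)).
exists x => f If.
have JE (g : {mpoly K[n]}) : J (g - g.@[x]%:MP).
  elim/mpoly_ring_ind: g => [b|i|p q Jp Jq|p q Jp Jq].
  - by rewrite mevalC subrr.
  - by rewrite mevalXU.
  - by rewrite mevalD mpolyCD opprD addrACA; exact: (JD).
  - rewrite mevalM mpolyCM.
    have -> : p * q - p.@[x]%:MP * q.@[x]%:MP =
      q * (p - p.@[x]%:MP) + p.@[x]%:MP * (q - q.@[x]%:MP) by ring.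
    by apply: (JD); exact: (JM).
have [//|fx0] := eqVneq f.@[x] 0; case: J1.
have : J (f.@[x]^-1%:MP * (f - (f - f.@[x]%:MP))).
  by apply: (JM); apply: (JD); [exact: IJ | rewrite -mulN1r; exact: (JM)].
by rewrite subKr -mpolyCM mulVf // mpolyC1.
Qed.

End Nullstellensatz.

(** If all fibres were finite, the line would be a countable union of finite sets, hence Lebesgue
    null, whereas its measure is infinite. *)
Lemma real_large_fiber (R : realType) (d : R -> nat) :
  exists k, forall N, exists s : seq R, [/\ uniq s, size s = N & {in s, forall x, d x = k}].
Proof.
have [k kinf] : exists k, infinite_set [set x | d x = k]%classic.
  apply: contrapT => fin.
  have : countable [set: R]%classic.
    have -> : [set: R]%classic = (\bigcup_(k in [set: nat]) [set x | d x = k])%classic.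
      by apply/seteqP; split=> // x _; exists (d x).
    apply: bigcup_countable => // k _; apply: finite_set_countable.
    by apply: contrapT => kinf; apply: fin; exists k.
  move=> /(@lebesgue_measure.countable_lebesgue_measure0 R).
  rewrite -set_itvNyy lebesgue_measure.lebesgue_measure_itv /=.
  by [].
exists k => N.
have [B Bk NB] := infinite_set_fset N kinf.
exists (take N (finmap.enum_fset B)); split.
- by rewrite take_uniq // finmap.fset_uniq.
- by rewrite size_takel.
- by move=> x /mem_take xB; exact: Bk.
Qed.

Lemma complex_large_fiber (R : realType) (d : complex R -> nat) :
  exists k, forall N, exists s : seq (complex R),
    [/\ uniq s, size s = N & {in s, forall x, d x = k}].
Proof.
have [k kP] := real_large_fiber (d \o real_complex R).
exists k => N; have [s [s_uniq sN sk]] := kP N.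
exists (map (real_complex R) s); split; rewrite ?size_map //.
  by rewrite map_inj_uniq //; exact: complexI.
by move=> _ /mapP[x xs ->]; exact: sk.
Qed.

(** * Polynomial rings are factorial *)

Section Divisibility.
Variable R : idomainType.
Implicit Types a b p : R.

Definition divs p a := exists c, a = c * p.
Definition prime_elt p :=
  [/\ p != 0, p \isn't a GRing.unit & forall a b, divs p (a * b) -> divs p a \/ divs p b].
Definition irreducible_elt p := [/\ p != 0, p \isn't a GRing.unit &
  forall a b, p = a * b -> a \is a GRing.unit \/ b \is a GRing.unit].

Lemma divs_mull p a b : divs p b -> divs p (a * b).
Proof. by move=> [c ->]; exists (a * c); rewrite mulrA. Qed.

Lemma divs_mulr p a b : divs p a -> divs p (a * b).
Proof. by rewrite mulrC; exact: divs_mull. Qed.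

Lemma divsD p a b : divs p a -> divs p b -> divs p (a + b).
Proof. by move=> [c ->] [d ->]; exists (c + d); rewrite mulrDl. Qed.

Lemma divsB p a b : divs p a -> divs p b -> divs p (a - b).
Proof. by move=> [c ->] [d ->]; exists (c - d); rewrite mulrBl. Qed.

End Divisibility.

(** The factors are prime and not merely irreducible: this carries the uniqueness of factorization
    and allows cancelling factors one by one. *)
Definition factorial_domain (R : idomainType) :=
  forall a : R, a != 0 -> exists u s,
    [/\ u \is a GRing.unit, forall p, p \in s -> prime_elt p & a = u * \prod_(p <- s) p].

Section GaussLemma.
Variable R : idomainType.
Implicit Types (f g h : {poly R}) (p c : R).

Lemma divsC_lead p f : divs p (lead_coef f) -> divs p%:P (lead_coef f *: 'X^((size f).-1)).
Proof. by move=> [c ->]; exists (c *: 'X^((size f).-1)); rewrite -scalerA -scalerAl [in RHS]mulrC mul_polyC. Qed.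

(** The product of the leading coefficients is divisible by [p], hence one of them is; removing that
    leading term shortens the pair and preserves divisibility of the product. *)
Lemma prime_polyC p : prime_elt p -> prime_elt p%:P.
Proof.
move=> [p0 pu pP]; split; first by rewrite polyC_eq0.
  apply: contra pu => /unitrP[q [_ pq]]; apply/unitrP; exists q`_0.
  have : (p%:P * q)`_0 = 1 by rewrite pq coef1.
  by rewrite coefCM mulrC => e; split=> //; rewrite mulrC.
move=> f g; have [N] := ubnP (size f + size g); elim: N f g => // N IH f g fgN pfg.
have [->|f0] := eqVneq f 0; first by left; exists 0; rewrite mul0r.
have [->|g0] := eqVneq g 0; first by right; exists 0; rewrite mul0r.
have tail h : h != 0 -> divs p (lead_coef h) -> exists h',
    [/\ (size h' < size h)%N, divs p%:P (h - h') & divs p%:P h' -> divs p%:P h].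
  move=> h0 ph; pose t := lead_coef h *: 'X^((size h).-1).
  have pt : divs p%:P t by exact: divsC_lead.
  exists (h - t); split; last 2 first.
  - by rewrite opprB addrCA subrr addr0.
  - by move=> pht; rewrite -(subrK t h); exact: divsD.
  have sh : size h = (size h).-1.+1 by rewrite prednK // size_poly_gt0.
  rewrite sh ltnS; apply/leq_sizeP => j hj; rewrite coefB coefZ coefXn.
  have [->|jh] := eqVneq j (size h).-1; first by rewrite mulr1 /lead_coef subrr.
  rewrite mulr0 subr0; apply: nth_default; rewrite sh ltn_neqAle eq_sym jh; exact: hj.
have : divs p (lead_coef f * lead_coef g).
  by have [q qE] := pfg; rewrite -lead_coefM qE lead_coefM lead_coefC; exists (lead_coef q).
move=> /pP[pf|pg].
  have [f' [f'f pff' pf'f]] := tail f f0 pf.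
  have : divs p%:P (f' * g).
    by rewrite (_ : f' * g = f * g - (f - f') * g); [exact/divsB/divs_mulr|ring].
  case/IH; [|by left; auto|by right].
  by apply: leq_trans (_ : (_ < size f + size g)%N) _; rewrite ?ltn_add2r // -ltnS.
have [g' [g'g pgg' pg'g]] := tail g g0 pg.
have : divs p%:P (f * g').
  by rewrite (_ : f * g' = f * g - f * (g - g')); [exact/divsB/divs_mull|ring].
case/IH; [|by left|by right; auto].
by apply: leq_trans (_ : (_ < size f + size g)%N) _; rewrite ?ltn_add2l // -ltnS.
Qed.

Hypothesis Rfact : factorial_domain R.

Definition primitive f := forall p, prime_elt p -> ~ divs p%:P f.

(* Gauss's lemma, by cancelling the prime factors of [c] one at a time. *)
Lemma strip_factor c f g h : primitive f -> c != 0 -> c *: f = g * h ->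
  exists g' h' : {poly R}, [/\ f = g' * h', size g' = size g & size h' = size h].
Proof.
move=> fprim c0; have [u [s [uu sP cE]]] := Rfact c0; rewrite {}cE.
elim: s sP g h {c0} => [|p s IH] sP g h.
  rewrite big_nil mulr1 => ufE; exists (u^-1 *: g), h.
  split=> //; last by rewrite size_scale // invr_eq0; apply: contraTneq uu => ->; rewrite unitr0.
  by rewrite -scalerAl -ufE scalerA mulVr // scale1r.
rewrite big_cons => E.
have pP : prime_elt p by apply: sP; rewrite mem_head.
have [p0 _ _] := pP.
have p0' : p%:P != 0 by rewrite polyC_eq0.
have [_ _ pPP] := prime_polyC pP.
have {}sP q : q \in s -> prime_elt q by move=> qs; apply: sP; rewrite inE qs orbT.
have : divs p%:P (g * h).
  by rewrite -E mulrCA -scalerA -mul_polyC mulrC; exists ((u * \prod_(j <- s) j) *: f).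
have sizeM (q : {poly R}) : size (q * p%:P) = size q by rewrite mulrC mul_polyC size_scale.
move=> /pPP[[g1 gE]|[h1 hE]].
  have [|g2 [h2 [fE sg sh]]] := IH sP g1 h.
    apply: (mulIf p0'); rewrite mulrAC -gE -E mulrC mul_polyC scalerA; congr (_ *: _); ring.
  by exists g2, h2; rewrite gE sizeM.
have [|g2 [h2 [fE sg sh]]] := IH sP g h1.
  apply: (mulIf p0'); rewrite -mulrA -hE -E mulrC mul_polyC scalerA; congr (_ *: _); ring.
by exists g2, h2; rewrite hE sizeM.
Qed.

(** A prime factor of [c] divides the product of [f] and the cofactor; as [f] is primitive it
    divides the cofactor, and it can be cancelled. *)
Lemma strip_divs c f g : primitive f -> c != 0 -> divs f (c *: g) -> divs f g.
Proof.
move=> fprim c0; have [u [s [uu sP cE]]] := Rfact c0; rewrite {}cE.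
elim: s sP g {c0} => [|p s IH] sP g.
  rewrite big_nil mulr1 => -[q qE]; exists (u^-1 *: q).
  by rewrite -scalerAl -qE scalerA mulVr // scale1r.
rewrite big_cons => -[q qE].
have pP : prime_elt p by apply: sP; rewrite mem_head.
have [p0 _ _] := pP.
have p0' : p%:P != 0 by rewrite polyC_eq0.
have [_ _ pPP] := prime_polyC pP.
have {}sP r : r \in s -> prime_elt r by move=> rs; apply: sP; rewrite inE rs orbT.
have : divs p%:P (q * f).
  by rewrite -qE mulrCA -scalerA -mul_polyC mulrC; exists ((u * \prod_(j <- s) j) *: g).
move=> /pPP[[q1 q1E]|/(fprim _ pP)//].
apply: IH => //; exists q1; apply: (mulIf p0').
by rewrite mulrAC -q1E -qE mulrC mul_polyC scalerA; congr (_ *: _); ring.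
Qed.

(** If [f] is not coprime to [a] over the fraction field, Gauss's lemma and irreducibility force
    their gcd to be [f] up to constants, and [f] divides [a]. If [f] is coprime to [a] and [b], it
    is coprime to [a * b], which is impossible for a multiple of [f]. *)
Lemma irreducible_poly_prime f : irreducible_elt f -> (1 < size f)%N -> prime_elt f.
Proof.
move=> [f0 fu fI] f1; split=> //.
have unit_size g : g \is a GRing.unit -> size g = 1%N.
  move=> /unitrP[h [hg _]]; have := congr1 (fun q : {poly R} => size q) hg.
  rewrite size_poly1 => E.
  have g0 : g != 0 by apply: contra_eq_neq E => ->; rewrite mulr0 size_poly0.
  have h0 : h != 0 by apply: contra_eq_neq E => ->; rewrite mul0r size_poly0.
  by move: E; rewrite size_mul //; move: g0 h0; rewrite -!size_poly_gt0; lia.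
have fprim : primitive f.
  move=> p pP [g gE]; have [_ pu _] := prime_polyC pP.
  have [gu|] := fI _ _ gE; last exact/negP.
  have [p0 _ _] := pP.
  by move: f1; rewrite gE mulrC mul_polyC size_scale // unit_size.
have small a : ~~ coprimep f a -> divs f a.
  rewrite coprimep_def => g1; set g := gcdp f a in g1.
  have g_neq0 : g != 0 by rewrite gcdp_eq0 negb_and f0.
  have /Pdiv.WeakIdomain.dvdpP[[c q] /= c0 fE] : g %| f by exact: dvdp_gcdl.
  have /Pdiv.WeakIdomain.dvdpP[[d r] /= d0 aE] : g %| a by exact: dvdp_gcdr.
  have [q' [g' [fE' sq sg]]] := strip_factor fprim c0 fE.
  have [qu|/unit_size g'1] := fI _ _ fE'; last by move: g1; rewrite -sg g'1.
  have /eqP/size_poly1P[e e0 qE] : size q = 1%N by rewrite -sq unit_size.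
  apply: (@strip_divs (e * d)); rewrite ?mulf_neq0 //.
  exists (c *: r); rewrite -scalerA aE scalerAr -(mul_polyC e) -qE.
  by rewrite -fE -scalerAr scalerAl.
move=> a b [c abE].
have [fa|/small] := boolP (coprimep f a); last by left.
have [fb|/small] := boolP (coprimep f b); last by right.
have : coprimep f (a * b) by rewrite coprimepMr fa.
rewrite abE coprimep_def (eqp_size (dvdp_gcd_idl _)) ?dvdp_mulIr //.
by move/eqP => E; rewrite E in f1.
Qed.

Lemma irreducible_polyC c : irreducible_elt c%:P -> prime_elt c%:P.
Proof.
move=> [c0 cu cI]; have c0' : c != 0 by rewrite -(polyC_eq0 c).
have [u [s [uu sP cE]]] := Rfact c0'.
case: s sP cE => [|p [|q s]] sP cE.
- by case/negP: cu; rewrite cE big_nil mulr1; exact: rmorph_unit.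
- have [p0 pu pP] : prime_elt p%:P by apply/prime_polyC/sP; rewrite mem_head.
  have uP : (u%:P : {poly R}) \is a GRing.unit by exact: rmorph_unit.
  have divE a : divs c%:P a <-> divs p%:P a.
    rewrite cE big_seq1 polyCM; split=> [[b ->]|[b ->]]; first by exists (b * u%:P); rewrite mulrA.
    by exists (b * (u%:P)^-1); rewrite mulrA divrK.
  by split=> // a b /divE /pP[] /divE; [left|right].
have [p0 pu _] : prime_elt p by apply: sP; rewrite mem_head.
have [q0 qu _] : prime_elt q by apply: sP; rewrite !inE eqxx orbT.
have Punit (a : R) : a%:P \is a GRing.unit -> a \is a GRing.unit by rewrite poly_unitE size_polyC coefC /= => /andP[].
have [] := cI p%:P (u * q * \prod_(j <- s) j)%:P.
- by rewrite -polyCM cE !big_cons; congr polyC; ring.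
- by move/Punit; rewrite (negbTE pu).
- by move/Punit; rewrite !unitrM (negbTE qu) andbF.
Qed.

End GaussLemma.

Section MpolyFactorial.
Variable K : fieldType.

Lemma mpoly_unit_msize n (f : {mpoly K[n]}) : msize f = 1%N -> f \is a GRing.unit.
Proof.
move=> /eqP/msize_poly1P[c c0 ->].
by apply: (rmorph_unit (@mpolyC n K)); rewrite unitfE.
Qed.

Lemma irreducible_factorization n (f : {mpoly K[n]}) : f != 0 -> exists u s,
  [/\ u \is a GRing.unit, forall p, p \in s -> irreducible_elt p & f = u * \prod_(p <- s) p].
Proof.
have [N] := ubnP (msize f); elim: N f => // N IH f fN f0.
have [fu|fu] := boolP (f \is a GRing.unit).
  by exists f, [::]; split=> //; rewrite big_nil mulr1.
have [fI|] := pselect (irreducible_elt f).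
  exists 1, [:: f]; split; [exact: unitr1| |by rewrite big_seq1 mul1r].
  by move=> p; rewrite inE => /eqP ->.
move=> fnI.
have [g [h [fE gu hu]]] : exists g h, [/\ f = g * h, g \isn't a GRing.unit & h \isn't a GRing.unit].
  apply: contrapT => ngh; apply: fnI; split=> // g h fE.
  have [|gu] := boolP (g \is a GRing.unit); first by left.
  have [|hu] := boolP (h \is a GRing.unit); first by right.
  by case: ngh; exists g, h.
have g0 : g != 0 by apply: contraNneq f0 => g0; rewrite fE g0 mul0r.
have h0 : h != 0 by apply: contraNneq f0 => h0; rewrite fE h0 mulr0.
have size_gt1 (k : {mpoly K[n]}) : k != 0 -> k \isn't a GRing.unit -> (1 < msize k)%N.
  move=> k0 ku; rewrite ltn_neqAle lt0n msize_poly_eq0 k0 andbT.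
  by apply: contra ku => /eqP/esym; exact: mpoly_unit_msize.
have g1 := size_gt1 g g0 gu; have h1 := size_gt1 h h0 hu.
have [|u [s [uu sI gE]]] := IH g _ g0.
  by move: fN h1; rewrite fE msizeM //; move: (msize g) (msize h) => x y; lia.
have [|v [t [vu tI hE]]] := IH h _ h0.
  by move: fN g1; rewrite fE msizeM //; move: (msize g) (msize h) => x y; lia.
exists (u * v), (s ++ t); split; first by rewrite unitrM uu.
  by move=> p; rewrite mem_cat => /orP[/sI|/tI].
by rewrite fE gE hE big_cat /=; ring.
Qed.

Lemma uni_unit n (j : 'I_n.+1) (f : {mpoly K[n.+1]}) :
  (uni j f \is a GRing.unit) = (f \is a GRing.unit).
Proof.
apply/idP/idP => [fu|]; last exact: rmorph_unit.
move/unitrP: fu => [g [/(congr1 (multi j)) gf /(congr1 (multi j)) fg]].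
rewrite rmorphM /= uniK rmorph1 in gf; rewrite rmorphM /= uniK rmorph1 in fg.
by apply/unitrP; exists (multi j g).
Qed.

Lemma uni_divs n (j : 'I_n.+1) (f g : {mpoly K[n.+1]}) :
  divs (uni j f) (uni j g) <-> divs f g.
Proof.
split=> [[c cE]|[c ->]]; last by exists (uni j c); rewrite rmorphM.
by exists (multi j c); apply: (can_inj (uniK j)); rewrite cE rmorphM /= multiK.
Qed.

Lemma uni_prime n (j : 'I_n.+1) (f : {mpoly K[n.+1]}) :
  prime_elt (uni j f) <-> prime_elt f.
Proof.
split=> -[f0 fu fP]; split.
- by apply: contraNneq f0 => ->; rewrite rmorph0.
- by rewrite -(uni_unit j).
- by move=> a b /(uni_divs j); rewrite rmorphM => /fP[] /uni_divs; [left|right].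
- by rewrite uni_eq0.
- by rewrite uni_unit.
- move=> a b; rewrite -(multiK j a) -(multiK j b) -rmorphM.
  by move=> /uni_divs/fP[] /(uni_divs j); [left|right].
Qed.

Theorem mpoly_factorial n : factorial_domain {mpoly K[n]}.
Proof.
elim: n => [|n IH] f f0.
  exists f, [::]; split=> //; last by rewrite big_nil mulr1.
  rewrite (nvar0_mpolyC f) in f0 *; rewrite mpolyC_eq0 in f0.
  by apply: (rmorph_unit (@mpolyC 0 K)); rewrite unitfE.
have [u [s [uu sI fE]]] := irreducible_factorization f0.
exists u, s; split=> // p /sI [p0 pu pI]; apply/(uni_prime ord0).
have pI' : irreducible_elt (uni ord0 p).
  split; first by rewrite uni_eq0.
    by rewrite uni_unit.
  move=> a b pE.
  have [] : multi ord0 a \is a GRing.unit \/ multi ord0 b \is a GRing.unit.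
  - by apply: pI; rewrite -rmorphM -pE /= uniK.
  - by rewrite -(uni_unit ord0) multiK; left.
  - by rewrite -(uni_unit ord0) multiK; right.
have [sp|] := ltnP 1 (size (uni ord0 p)); first exact: irreducible_poly_prime.
by move/size1_polyC => pE; move: pI'; rewrite pE => /(irreducible_polyC IH).
Qed.

End MpolyFactorial.

(** * Descent along an etale map *)

Lemma resultant_rmorph (S T : idomainType) (f : {rmorphism {poly S} -> T}) (p q : {poly S})
    (a b r : T) :
  (1 < size p)%N -> (1 < size q)%N -> f p = a -> f q = b -> f (resultant p q)%:P = r ->
  exists x y, r = x * a + y * b.
Proof.
move=> sp sq <- <- <-; have [[x y] _ /= ->] := resultant_in_ideal sp sq.
by exists (f x), (f y); rewrite rmorphD !rmorphM.
Qed.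

Section CharZero.
Variable K : numFieldType.

Lemma msize_mderiv_lt n (r : {mpoly K[n]}) j : r != 0 -> (msize r^`M(j) < msize r)%N.
Proof.
move=> r0; have r_gt0 : (0 < msize r)%N by rewrite lt0n msize_poly_eq0.
rewrite -(prednK r_gt0) ltnS [X in (X <= _)%N]msizeE; apply/bigmax_leqP_seq => m.
rewrite -ltnS prednK // mcoeff_msupp mcoeff_deriv => mr _.
have : (m + U_(j))%MM \in msupp r.
  by rewrite mcoeff_msupp; apply: contraNneq mr => ->; rewrite mul0rn.
by move/msize_mdeg_lt; rewrite mdegD mdeg1 addn1.
Qed.

Lemma mderiv0_const n (r : {mpoly K[n]}) : (forall j, r^`M(j) = 0) -> r = (r@_0%MM)%:MP.
Proof.
move=> dr; apply/mpolyP => m; rewrite mcoeffC.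
have [->|m0] := eqVneq m 0%MM; first by rewrite mulr1.
rewrite mulr0; have [j mj] : exists j, m j != 0%N.
  apply/existsP; apply: contraR m0; rewrite negb_exists => /forallP m0.
  by apply/eqP/mnmP => i; rewrite mnm0E; apply/eqP; have := m0 i; rewrite negbK.
have := congr1 (mcoeff (m - U_(j))) (dr j); rewrite mcoeff_deriv mcoeff0.
rewrite submK; last by rewrite lep1mP.
by move/eqP; rewrite mulrn_eq0 /= => /eqP.
Qed.

Lemma mderiv0_unit n (r : {mpoly K[n]}) : r != 0 -> (forall j, r^`M(j) = 0) ->
  r \is a GRing.unit.
Proof.
move=> r0 /mderiv0_const rE; apply: mpoly_unit_msize; rewrite rE msizeC.
by apply/eqP; rewrite eqb1; apply: contraNneq r0 => c0; rewrite rE c0 mpolyC0.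
Qed.

Lemma mpoly_unitE n (r : {mpoly K[n]}) : r \is a GRing.unit -> exists2 c, c != 0 & r = c%:MP.
Proof.
move=> /unitrP[s [sr _]]; apply/msize_poly1P; rewrite eqn_leq.
have s0 : s != 0 by apply: contra_eq_neq sr => ->; rewrite mul0r eq_sym oner_neq0.
have r0 : r != 0 by apply: contra_eq_neq sr => ->; rewrite mulr0 eq_sym oner_neq0.
have := congr1 (fun f : {mpoly K[n]} => msize f) sr; rewrite msizeM // msize1.
move: r0 s0; rewrite -!msize_poly_eq0 -!lt0n.
move: (msize r) (msize s) => x y; lia.
Qed.

Lemma mderiv_omit_var n (j : 'I_n.+1) (p : {mpoly K[n]}) : (omit_var j p)^`M(j) = 0.
Proof.
rewrite comp_mpoly_mderiv big1 // => i _; rewrite tnth_mktuple mderiv_var.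
by rewrite eq_sym (negbTE (neq_lift _ _)) mulr0.
Qed.

(** [r] is the resultant with respect to the variable [j]: a common factor of positive degree would,
    by primality of [A], make [A] divide [B]. If [b] does not involve that variable, [b] itself
    serves as [r]. *)
Lemma uni_resultant n (j : 'I_n.+1) (a b : {mpoly K[n.+1]}) :
  prime_elt a -> a^`M(j) != 0 -> ~ divs a b ->
  exists r x y, r != 0 /\ omit_var j r = x * a + y * b.
Proof.
move=> aP aj nab; set A := uni j a; set B := uni j b.
have size_A : (1 < size A)%N.
  rewrite ltnNge; apply: contra aj => /size1_polyC AE.
  by rewrite -(uniK j a) -/A AE multiC mderiv_omit_var.
have size_B : (1 < size B)%N \/ (size B <= 1)%N by case: ltnP; [left|right].
have A0 : A != 0 by rewrite -size_poly_gt0 ltnW.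
have [A0' Au AP] : prime_elt A by apply/uni_prime.
have nAB : ~ divs A B by move=> /uni_divs.
have rP : (size B <= 1)%N \/ resultant A B != 0 /\ (1 < size B)%N.
  case: size_B => [sB|]; [right; split=> //|by left].
  rewrite resultant_eq0 -leqNgt leqNgt; apply/negP => sg.
  have /Pdiv.WeakIdomain.dvdpP[[c x] /= c0 AE] : gcdp A B %| A by exact: dvdp_gcdl.
  have /Pdiv.WeakIdomain.dvdpP[[d y] /= d0 BE] : gcdp A B %| B by exact: dvdp_gcdr.
  have : divs A (x * gcdp A B) by exists c%:P; rewrite -AE mul_polyC.
  move=> /AP[[w xE]|Ag].
    have : c%:P = w * gcdp A B.
      by apply: (mulIf A0); rewrite mul_polyC AE xE; ring.
    move=> /(congr1 (fun p : {poly _} => size p)); rewrite size_polyC c0 => E.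
    have w0 : w != 0 by apply: contra_eq_neq E => ->; rewrite mul0r size_poly0.
    have g0 : gcdp A B != 0 by rewrite -size_poly_gt0 ltnW.
    move: E sg; rewrite size_mul //; move: w0; rewrite -size_poly_gt0 /=.
    by move: (size w) (size (gcdp A B)) => y' z; lia.
  have : divs A (d%:P * B) by rewrite mul_polyC BE; exact: divs_mull.
  move=> /AP[[w dE]|//].
  have : size d%:P = 1%N by rewrite size_polyC d0.
  have w0 : w != 0 by apply: contraNneq d0 => w0; rewrite -(polyC_eq0 d) dE w0 mul0r.
  rewrite dE size_mul //; move: w0 size_A; rewrite -size_poly_gt0 /=.
  by move: (size w) (size A) => y' z; lia.
case: rP => [/size1_polyC BE|[r0 sB]].
  exists B`_0, 0, 1; split; last by rewrite -multiC -BE uniK mul0r add0r mul1r.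
  by apply/eqP => B0; apply: nab; exists 0; rewrite -(uniK j b) -/B BE B0 rmorph0 mul0r.
have [x [y E]] := resultant_rmorph (f := multi j) size_A sB (uniK j a) (uniK j b) (multiC _ _).
by exists (resultant A B), x, y.
Qed.

Lemma prime_elimination n (j : 'I_n) (a b : {mpoly K[n]}) :
  prime_elt a -> a^`M(j) != 0 -> ~ divs a b ->
  exists r x y, [/\ r != 0, r^`M(j) = 0 & r = x * a + y * b].
Proof.
case: n j a b => [[] //|n] j a b aP aj nab.
have [r [x [y [r0 rE]]]] := uni_resultant aP aj nab.
exists (omit_var j r), x, y; split=> //; last exact: mderiv_omit_var.
by rewrite -(rmorph0 (omit_var j)) (inj_eq (@omit_var_inj _ _ _)).
Qed.

Section EtaleDescent.
Variables (n : nat) (F : n.-tuple {mpoly K[n]}) (c : K).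
Let J : 'M[{mpoly K[n]}]_n := \matrix_(j, k) (tnth F j)^`M(k).
Hypotheses (c0 : c != 0) (detJ : \det J = c%:MP).

(** Since [\det J] is a nonzero constant, the adjugate inverts [J] over the polynomial ring itself,
    so the system can be solved modulo any ideal. It is used with the zero ideal and with the
    multiples of [P]. *)
Lemma jacobian_ideal (I : {mpoly K[n]} -> Prop) (g : 'I_n -> {mpoly K[n]}) : ideal I ->
  (forall k, I (\sum_j g j * (tnth F j)^`M(k))) -> forall j, I (g j).
Proof.
move=> II gJ j; have [_ _ IM] := II.
pose G := \row_i g i.
have : G *m J *m \adj J = c%:MP *: G by rewrite -mulmxA mul_mx_adj detJ mul_mx_scalar.
move=> /(congr1 (fun M : 'rV_n => c^-1%:MP * M 0 j)).
rewrite !mxE mulrA -mpolyCM mulVf // mul1r => <-.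
apply: (IM); apply: ideal_sum => // k; rewrite mulrC; apply: (IM).
have := gJ k; congr (I _); rewrite !mxE; apply: eq_bigr => i _.
by rewrite !mxE.
Qed.

(** Algebraic independence of the components of [F]: differentiating a relation and inverting the
    Jacobian shows that the derivatives of [r] are relations of lower degree, hence zero, so [r] is
    a constant. *)
Lemma comp_mpoly_eq0 (r : {mpoly K[n]}) : r \mPo F = 0 -> r = 0.
Proof.
have [N] := ubnP (msize r); elim: N r => // N IH r rN rF.
have [//|r0] := eqVneq r 0.
have dr j : r^`M(j) = 0.
  apply: IH; first by rewrite -ltnS; apply: leq_trans rN; rewrite ltnS msize_mderiv_lt.
  have idl0 : ideal (fun f : {mpoly K[n]} => f = 0).
    by split=> // [f g -> ->|f g ->]; rewrite ?addr0 ?mulr0.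
  by move: j; apply: (jacobian_ideal idl0) => k; rewrite -comp_mpoly_mderiv rF mderiv0.
by move: rF; rewrite [X in X \mPo _ = _](mderiv0_const dr) comp_mpolyC => e; rewrite (mderiv0_const dr).
Qed.

Section Contraction.
Variable P : {mpoly K[n]}.
Hypothesis PP : prime_elt P.
(* The contraction along [F] of the prime ideal generated by [P]. *)
Let pp r := divs P (r \mPo F).

Lemma ideal_divs : ideal (divs P).
Proof.
split; [by exists 0; rewrite mul0r|by move=> f g; exact: divsD|].
by move=> f g; exact: divs_mull.
Qed.

Lemma contraction_unit r : r \is a GRing.unit -> ~ pp r.
Proof.
have [P0 Pu _] := PP.
move=> ru [x xE]; case/negP: Pu.
have := rmorph_unit (comp_mpoly F) ru; rewrite /= xE unitrM => /andP[] //.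
Qed.

Lemma contraction_prime r s : pp (r * s) -> pp r \/ pp s.
Proof. by have [_ _ Pp] := PP; rewrite /pp rmorphM; exact: Pp. Qed.

Lemma contraction_combine x y r s : pp r -> pp s -> pp (x * r + y * s).
Proof.
by move=> pr ps; rewrite /pp rmorphD !rmorphM; apply: divsD; exact: divs_mull.
Qed.

(* Modulo [P], the gradients of all elements of the contraction are parallel:
   both are multiples of the gradient of [P] transported by the Jacobian of [F]. *)
Lemma contraction_gradient a r j : pp a -> ~ pp a^`M(j) -> pp r -> r^`M(j) = 0 ->
  forall i, pp r^`M(i).
Proof.
have [_ _ Pp] := PP.
move=> [X aX] aj [Y rY] rj.
have dE s S l : s \mPo F = S * P ->
    \sum_i (s^`M(i) \mPo F) * (tnth F i)^`M(l) = S^`M(l) * P + S * P^`M(l).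
  by move=> sE; rewrite -comp_mpoly_mderiv sE mderivM.
have par i : divs P (Y * (a^`M(i) \mPo F) - X * (r^`M(i) \mPo F)).
  move: i; apply: (jacobian_ideal ideal_divs) => l.
  have -> : \sum_i (Y * (a^`M(i) \mPo F) - X * (r^`M(i) \mPo F)) * (tnth F i)^`M(l) =
      Y * (X^`M(l) * P + X * P^`M(l)) - X * (Y^`M(l) * P + Y * P^`M(l)).
    rewrite -(dE _ _ _ aX) -(dE _ _ _ rY) !mulr_sumr -sumrB; apply: eq_bigr => i _.
    by rewrite mulrBl !mulrA.
  by exists (Y * X^`M(l) - X * Y^`M(l)); ring.
have PY : divs P Y.
  have := par j; rewrite rj comp_mpoly0 mulr0 subr0 => /Pp[//|].
  by move/aj.
(* Otherwise [P ^+ 2] divides [a \mPo F], so [P] divides its whole gradient, and inverting the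
   Jacobian puts the derivative of [a] along [j] in the contraction. *)
have nPX : ~ divs P X.
  move=> PX; apply: aj; apply: (jacobian_ideal ideal_divs (g := fun j => a^`M(j) \mPo F)) => l.
  by rewrite (dE _ _ _ aX); apply: divsD; [exists (X^`M(l)) | exact: divs_mulr].
move=> i; have : divs P (X * (r^`M(i) \mPo F)).
  rewrite -[_ * _](subKr (Y * (a^`M(i) \mPo F))); apply: divsB; last exact: par.
  exact: divs_mulr.
by move=> /Pp[/nPX|].
Qed.

End Contraction.

(** Let [a] be a prime of least degree in the contraction, and [j] a variable along which its
    derivative is not there. A member not divisible by [a] yields, by elimination, a nonzero member
    free of that variable. If [r] is one of least degree, its derivatives are again members free of
    that variable, hence zero by minimality; so [r] is a unit, which is absurd. *)
Lemma contraction_principal (P q p : {mpoly K[n]}) : prime_elt P ->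
  q != 0 -> divs P (q \mPo F) -> divs P (p \mPo F) ->
  exists a, [/\ (1 < msize a)%N, divs a q & divs a p].
Proof.
move=> PP q0; pose pp r := divs P (r \mPo F); rewrite -/(pp q) -/(pp p) => pq p_p.
have minP (T : Type) (Q : T -> Prop) (sz : T -> nat) : (exists x, Q x) ->
    exists2 x, Q x & forall y, Q y -> (sz x <= sz y)%N.
  move=> [x0 Qx0].
  have exN : exists m, `[< exists2 x, Q x & sz x = m >] by exists (sz x0); apply/asboolP; exists x0.
  case: (ex_minnP exN) => m /asboolP[x Qx <-] mP.
  by exists x => // y Qy; apply: mP; apply/asboolP; exists y.
have [m [m0 pm] mmin] : exists2 a, a != 0 /\ pp a & forall b, b != 0 /\ pp b -> (msize a <= msize b)%N.
  by apply: (minP _ (fun a => a != 0 /\ pp a) (fun a => msize a)); exists q.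
(* The minimal element [m] may fail to be prime, but one of its prime factors lies in the
   contraction and has no larger degree. *)
have [a [aP pa amin]] : exists a, [/\ prime_elt a, pp a &
    forall b, b != 0 -> pp b -> (msize a <= msize b)%N].
  have [u [s [uu sP mE]]] := mpoly_factorial m0.
  have : pp (\prod_(b <- s) b).
    by move: pm; rewrite mE => /(contraction_prime PP)[/(contraction_unit PP uu)|].
  have : forall b, b \in s -> (msize b <= msize m)%N.
    move=> b bs; have [w mw] : divs b m.
      by rewrite mE (big_rem b) //=; apply: divs_mull; apply: divs_mulr; exists 1; rewrite mul1r.
    have b0 : b != 0 by case: (sP b bs).
    have w0 : w != 0 by apply: contraNneq m0 => w0; rewrite mw w0 mul0r.
    rewrite mw msizeM //; move: w0; rewrite -msize_poly_eq0 -lt0n.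
    by move: (msize w) (msize b) => x y; lia.
  elim: s sP {mE} => [|b s IH] sP bs; rewrite ?big_nil ?big_cons.
    by move=> /(contraction_unit PP (unitr1 _)).
  move=> /(contraction_prime PP)[pb|]; last first.
    by apply: IH => b' b's; [apply: sP|apply: bs]; rewrite inE b's orbT.
  exists b; split=> [||b' b'0 pb'] //; first by apply: sP; rewrite mem_head.
  by apply: leq_trans (mmin b' _) => //; apply: bs; rewrite mem_head.
have a0 : a != 0 by case: aP.
have [j aj] : exists j, ~ pp a^`M(j).
  apply: contrapT => naj; have [_ /negP au _] := aP; apply: au; apply: mderiv0_unit => // j.
  apply: contrapT => /eqP aj0; have := msize_mderiv_lt j a0; rewrite ltnNge => /negP; apply.
  by apply: amin => //; apply: contrapT => npj; apply: naj; exists j.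
have a_dvd b : pp b -> divs a b.
  move=> pb; apply: contrapT => nab.
  have aj0 : a^`M(j) != 0.
    by apply: contra_notN aj => /eqP ->; rewrite /pp comp_mpoly0; exists 0; rewrite mul0r.
  have [r1 [x [y [r10 r1j r1E]]]] := prime_elimination aP aj0 nab.
  have pr1 : pp r1 by rewrite r1E; exact: contraction_combine.
  have [r [r0 rj pr] rmin] := minP _ (fun r => [/\ r != 0, r^`M(j) = 0 & pp r])
    (fun r => msize r) (ex_intro _ r1 (And3 r10 r1j pr1)).
  suff /(contraction_unit PP) : r \is a GRing.unit by [].
  apply: mderiv0_unit => // i; apply: contrapT => /eqP ri0.
  have := msize_mderiv_lt i r0; rewrite ltnNge => /negP; apply; apply: rmin; split=> //.
    by rewrite mderiv_comm rj mderiv0.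
  exact: (contraction_gradient PP pa aj pr rj).
exists a; split; [|exact: a_dvd|exact: a_dvd].
rewrite ltnNge; apply/negP => /msize1_polyC aE.
have [_ /negP au _] := aP; apply: au; apply: mpoly_unit_msize.
by rewrite aE msizeC; apply/eqP; rewrite eqb1; apply: contraNneq a0 => e; rewrite aE e mpolyC0.
Qed.

Theorem birational_descent (q p x : {mpoly K[n]}) : q != 0 ->
  (q \mPo F) * x = p \mPo F -> exists g, x = g \mPo F.
Proof.
have [N] := ubnP (msize q); elim: N q p => // N IH q p qN q0 qx.
have [/mpoly_unitE[b b0 qE]|qu] := boolP (q \mPo F \is a GRing.unit).
  exists (b^-1%:MP * p); rewrite rmorphM /= comp_mpolyC -qx qE mulrA -mpolyCM mulVf //.
  by rewrite mul1r.
have qF0 : q \mPo F != 0 by apply: contraNneq q0 => /comp_mpoly_eq0 ->.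
have [u [s [uu sP qE]]] := mpoly_factorial qF0.
case: s sP qE => [|P s] sP qE; first by move: qu; rewrite qE big_nil mulr1 uu.
have PP : prime_elt P by apply: sP; rewrite mem_head.
have pq : divs P (q \mPo F).
  by rewrite qE big_cons; apply: divs_mull; apply: divs_mulr; exists 1; rewrite mul1r.
have p_p : divs P (p \mPo F) by rewrite -qx; exact: divs_mulr.
have [a [a1 [q' q'E] [p' p'E]]] := contraction_principal PP q0 pq p_p.
have a0 : a != 0 by apply: contraTneq a1 => ->; rewrite msize0.
have q'0 : q' != 0 by apply: contraNneq q0 => e; rewrite q'E e mul0r.
apply: (IH q' p') => //.
  by move: qN a1; rewrite q'E msizeM //; move: (msize q') (msize a) => y z; lia.
have aF0 : a \mPo F != 0 by apply: contraNneq a0 => /comp_mpoly_eq0 ->.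
by apply: (mulIf aF0); rewrite mulrAC -!rmorphM -q'E -p'E.
Qed.

End EtaleDescent.
End CharZero.

(** * Injectivity and birationality *)

Lemma mulrB_split (A : comNzRingType) (a a' b b' : A) :
  a * b - a' * b' = a * (b - b') + b' * (a - a').
Proof. by ring. Qed.

Section Doubling.
Variables (R : comNzRingType) (n : nat).

Definition left_vars (p : {mpoly R[n]}) : {mpoly R[n + n]} :=
  p \mPo [tuple 'X_(lshift n i) | i < n].
Definition right_vars (p : {mpoly R[n]}) : {mpoly R[n + n]} :=
  p \mPo [tuple 'X_(rshift n i) | i < n].

Lemma meval_left_vars p (z : 'I_(n + n) -> R) : (left_vars p).@[z] = p.@[fun i => z (lshift n i)].
Proof.
by rewrite comp_mpoly_meval; apply: meval_eq => i; rewrite tnth_mktuple mevalXU.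
Qed.

Lemma meval_right_vars p (z : 'I_(n + n) -> R) : (right_vars p).@[z] = p.@[fun i => z (rshift n i)].
Proof.
by rewrite comp_mpoly_meval; apply: meval_eq => i; rewrite tnth_mktuple mevalXU.
Qed.

(** Divided differences, built by the Leibniz rule. On the diagonal they become partial derivatives,
    so the matrix they form for [F] restricts there to the Jacobian. *)
Lemma mpoly_difference (p : {mpoly R[n]}) : exists m : 'I_n -> {mpoly R[n + n]},
  left_vars p - right_vars p = \sum_k m k * ('X_(lshift n k) - 'X_(rshift n k)) /\
  forall k (z : 'I_(n + n) -> R), (forall i, z (lshift n i) = z (rshift n i)) ->
    (m k).@[z] = p^`M(k).@[fun i => z (lshift n i)].
Proof.
elim/mpoly_ring_ind: p => [c|i|p q [m [pE mE]] [m' [qE mE']]|p q [m [pE mE]] [m' [qE mE']]].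
- exists (fun=> 0); split=> [|k z _]; last by rewrite mderivC !meval0.
  by rewrite /left_vars /right_vars !comp_mpolyC subrr big1 // => k _; rewrite mul0r.
- exists (fun k => (i == k)%:R); split=> [|k z _].
    rewrite (bigD1 i) //= eqxx mul1r big1 => [|k ki].
      by rewrite addr0 /left_vars /right_vars !comp_mpolyXU -!tnth_nth !tnth_mktuple.
    by rewrite eq_sym (negbTE ki) mul0r.
  by rewrite mderiv_var; case: (i == k); rewrite ?meval0 ?meval1.
- exists (fun k => m k + m' k); split=> [|k z zE].
    rewrite /left_vars /right_vars !comp_mpolyD -/(left_vars _) -/(left_vars _) opprD addrACA.
    by rewrite pE qE -big_split /=; apply: eq_bigr => k _; rewrite mulrDl.
  by rewrite mderivD !mevalD mE // mE'.
- exists (fun k => left_vars p * m' k + right_vars q * m k); split=> [|k z zE].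
    have -> : left_vars (p * q) - right_vars (p * q) =
        left_vars p * (left_vars q - right_vars q) + right_vars q * (left_vars p - right_vars p).
      have -> : left_vars (p * q) = left_vars p * left_vars q by exact: (rmorphM (comp_mpoly _)).
      have -> : right_vars (p * q) = right_vars p * right_vars q by exact: (rmorphM (comp_mpoly _)).
      exact: mulrB_split.
    rewrite pE qE !mulr_sumr -big_split /=.
    by apply: eq_bigr => k _; rewrite !mulrA mulrDl.
  rewrite mderivM !(mevalD, mevalM) meval_left_vars meval_right_vars mE // mE' //.
  rewrite addrC; congr (_ + _); rewrite mulrC; congr (_ * _).
  by apply: meval_eq => i; rewrite zE.
Qed.

End Doubling.

Section Certificate.
Variables (K : numClosedFieldType) (n : nat).
Hypothesis large_fiber : forall d : K -> nat, exists k, forall N, exists s : seq K,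
  [/\ uniq s, size s = N & {in s, forall x, d x = k}].

Variables (F : n.-tuple {mpoly K[n]}) (c : K).
Hypothesis c0 : c != 0.
Hypothesis detJ : \det (\matrix_(j, k) (tnth F j)^`M(k)) = c%:MP :> {mpoly K[n]}.
Hypothesis F_inj : forall x y : 'I_n -> K,
  (forall j, (tnth F j).@[x] = (tnth F j).@[y]) -> x =1 y.

(** By injectivity the [d j] vanish together only on the diagonal, where [\det M] equals [c]; so 1
    is a combination of [\det M] and the [d j]. Multiply it by [X_i - Y_i]: the adjugate of [M]
    expresses [\det M * (X_i - Y_i)] through the [d j]. This gives [X_i - Y_i] itself rather than a
    power of it. *)
Lemma injectivity_certificate i : exists b : 'I_n -> {mpoly K[n + n]},
  'X_(lshift n i) - 'X_(rshift n i) =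
  \sum_j b j * (left_vars (tnth F j) - right_vars (tnth F j)).
Proof.
pose d j := left_vars (tnth F j) - right_vars (tnth F j); rewrite -/d.
have [m mP] := fin_all_exists (fun j => mpoly_difference (tnth F j)).
pose M : 'M[{mpoly K[n + n]}]_n := \matrix_(j, k) m j k.
pose I f := exists s (a : 'I_n -> {mpoly K[n + n]}), f = s * \det M + \sum_j a j * d j.
have II : ideal I.
  split.
  - by exists 0, (fun=> 0); rewrite mul0r add0r big1 // => j _; rewrite mul0r.
  - move=> _ _ [s [a ->]] [s' [a' ->]]; exists (s + s'), (fun j => a j + a' j).
    by under [in RHS]eq_bigr do rewrite mulrDl; rewrite big_split mulrDl addrACA.
  - move=> f _ [s [a ->]]; exists (f * s), (fun j => f * a j).
    by under [in RHS]eq_bigr do rewrite -mulrA; rewrite -mulr_sumr mulrDr mulrA.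
have [s [a saE]] : I 1.
  apply: contrapT => /(weak_nullstellensatz large_fiber II)[z zI].
  have zE k : z (lshift n k) = z (rshift n k).
    apply: (F_inj (x := fun i => z (lshift n i)) (y := fun i => z (rshift n i))) => j.
    apply/eqP; rewrite -subr_eq0 -meval_left_vars -meval_right_vars -mevalB; apply/eqP.
    apply: zI; exists 0, (fun l => (l == j)%:R); rewrite mul0r add0r (bigD1 j) //= eqxx mul1r.
    by rewrite big1 ?addr0 // => l lj; rewrite (negbTE lj) mul0r.
  have : (\det M).@[z] = 0.
    by apply: zI; exists 1, (fun=> 0); rewrite mul1r big1 ?addr0 // => j _; rewrite mul0r.
  rewrite -det_map_mx; suff -> : map_mx (meval z) M =
      map_mx (meval (fun i => z (lshift n i))) (\matrix_(j, k) (tnth F j)^`M(k)).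
    by rewrite det_map_mx detJ /= mevalC => /eqP; rewrite (negbTE c0).
  by apply/matrixP => j k; rewrite !mxE; have [_ ->] := mP j.
pose D := \col_j d j : 'cV_n.
pose V := \col_k ('X_(lshift n k) - 'X_(rshift n k)) : 'cV[{mpoly K[n + n]}]_n.
have DV : D = M *m V.
  by apply/colP => j; rewrite !mxE /d; have [-> _] := mP j; apply: eq_bigr => k _; rewrite !mxE.
exists (fun j => s * (\adj M) i j + ('X_(lshift n i) - 'X_(rshift n i)) * a j).
have adjE : \det M * ('X_(lshift n i) - 'X_(rshift n i)) = \sum_j (\adj M) i j * d j.
  transitivity ((\adj M *m D) i 0); last by rewrite mxE; apply: eq_bigr => j _; rewrite [D j 0]mxE.
  by rewrite DV mulmxA mul_adj_mx mul_scalar_mx !mxE.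
under eq_bigr do rewrite mulrDl -!mulrA.
rewrite big_split /= -!mulr_sumr -adjE mulrA mulrC -mulrDr -[LHS]mulr1; congr (_ * _).
exact: saE.
Qed.

End Certificate.

(** * Partial functionals linear over K[F] *)

Section Functional.
Variables (K : numFieldType) (n : nat) (F : n.-tuple {mpoly K[n]}).
Implicit Types (b y : {mpoly K[n]}) (r d : {mpoly K[n]}) (G : {mpoly K[n]} -> {mpoly K[n]} -> Prop).
Hypothesis F_free : forall r, (r \mPo F) = 0 -> r = 0.

(* The graph of a partial [K[F]]-linear map from [K[X]] to itself. *)
Definition lin_graph G := [/\ G 0 0, forall b y b' y', G b y -> G b' y' -> G (b + b') (y + y'),
  forall r b y, G b y -> G ((r \mPo F) * b) ((r \mPo F) * y) & forall y, G 0 y -> y = 0].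

(** If a nonzero multiple [(d \mPo F) * v] already has a value [y0], then [v] should go to [y0]
    divided by [d \mPo F]; multiplying the whole map by [d \mPo F] clears the denominator. Otherwise
    [v] is independent of the domain and is sent to 0. *)
Lemma lin_graph_extend G v : lin_graph G -> exists G' d, [/\ lin_graph G', d != 0,
  forall b y, G b y -> G' b ((d \mPo F) * y) & exists y, G' v y].
Proof.
move=> [G0 GD GM Gf].
have [[d [y0 [d0 Gd]]]|nd] := pselect (exists d y, d != 0 /\ G ((d \mPo F) * v) y).
  exists (fun b' y' => exists b y r, [/\ G b y, b' = b + (r \mPo F) * v &
    y' = (d \mPo F) * y + (r \mPo F) * y0]), d; split=> //; last first.
  - by exists y0, 0, 0, 1; rewrite comp_mpoly1 mulr0 !mul1r !add0r.
  - by move=> b y Gby; exists b, y, 0; rewrite comp_mpoly0 !mul0r !addr0.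
  split.
  - by exists 0, 0, 0; rewrite comp_mpoly0 mulr0 !mul0r !addr0.
  - move=> _ _ _ _ [b [y [r [Gby -> ->]]]] [b' [y' [r' [Gby' -> ->]]]].
    exists (b + b'), (y + y'), (r + r'); split; first exact: GD.
      by rewrite comp_mpolyD mulrDl addrACA.
    by rewrite comp_mpolyD mulrDr mulrDl addrACA.
  - move=> s _ _ [b [y [r [Gby -> ->]]]].
    exists ((s \mPo F) * b), ((s \mPo F) * y), (s * r); split; first exact: GM.
      by rewrite rmorphM mulrDr mulrA.
    by rewrite rmorphM mulrDr mulrCA !mulrA.
  move=> _ [b [y [r [Gby bE ->]]]]; apply: Gf.
  have := GD _ _ _ _ (GM d _ _ Gby) (GM r _ _ Gd).
  by rewrite mulrCA -mulrDr -bE mulr0.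
exists (fun b' y => exists b r, G b y /\ b' = b + (r \mPo F) * v), 1; split; last 3 first.
- exact: oner_neq0.
- by move=> b y Gby; exists b, 0; rewrite comp_mpoly0 mul0r addr0 comp_mpoly1 mul1r.
- by exists 0, 0, 1; rewrite comp_mpoly1 add0r mul1r.
split.
- by exists 0, 0; rewrite comp_mpoly0 mul0r addr0.
- move=> _ y _ y' [b [r [Gby ->]]] [b' [r' [Gby' ->]]].
  exists (b + b'), (r + r'); split; first exact: GD.
  by rewrite comp_mpolyD mulrDl addrACA.
- move=> s _ y [b [r [Gby ->]]]; exists ((s \mPo F) * b), (s * r); split; first exact: GM.
  by rewrite rmorphM mulrDr mulrA.
move=> y [b [r [Gby bE]]].
have r0 : r = 0.
  apply/eqP; apply: contrapT => /negP r0; apply: nd; exists r, (- y); split=> //.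
  have := GM (-1) _ _ Gby; rewrite rmorphN1 !mulN1r; congr (G _ _).
  by apply/eqP; rewrite eqr_oppLR -addr_eq0 -bE eqxx.
by apply: Gf; move: bE Gby; rewrite r0 comp_mpoly0 mul0r addr0 => <-.
Qed.

(** The starting map sends [(p \mPo F) + (q \mPo F) * x] to [q \mPo F], which is well defined by the
    hypothesis on [x]. Each extension multiplies the value at [x] by a nonzero factor and keeps the
    value 0 at 1. *)
Lemma lin_graph_list x (s : seq {mpoly K[n]}) :
  (forall q p, (q \mPo F) * x = (p \mPo F) -> q = 0) ->
  exists G e, [/\ lin_graph G, e != 0, G 1 0 /\ G x e & forall v, v \in s -> exists y, G v y].
Proof.
move=> xF; elim: s => [|v s [G [e [Glin e0 [G1 Gx] Gs]]]].
  exists (fun b y => exists p q, b = (p \mPo F) + (q \mPo F) * x /\ y = q \mPo F), 1.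
  split=> //; last first.
  - split; first by exists 1, 0; rewrite comp_mpoly1 comp_mpoly0 mul0r addr0.
    by exists 0, 1; rewrite comp_mpoly1 comp_mpoly0 mul1r add0r.
  - exact: oner_neq0.
  split.
  - by exists 0, 0; rewrite comp_mpoly0 mul0r addr0.
  - move=> _ _ _ _ [p [q [-> ->]]] [p' [q' [-> ->]]]; exists (p + p'), (q + q').
    by rewrite !comp_mpolyD mulrDl addrACA.
  - move=> r _ _ [p [q [-> ->]]]; exists (r * p), (r * q).
    by rewrite !rmorphM mulrDr mulrA.
  move=> _ [p [q [pqE ->]]]; suff -> : q = 0 by rewrite comp_mpoly0.
  by apply: (xF q (- p)); apply/eqP; rewrite comp_mpolyN -addr_eq0 addrC -pqE eqxx.
have [G' [d [G'lin d0 GG' vG']]] := lin_graph_extend v Glin.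
have dF0 : (d \mPo F) != 0 by apply: contraNneq d0 => /F_free ->.
exists G', ((d \mPo F) * e); split=> //; first by rewrite mulf_neq0.
  by split; [rewrite -(mulr0 (d \mPo F)); exact: GG' | exact: GG'].
move=> w; rewrite inE => /orP[/eqP -> //|/Gs [y /GG' Gy]].
by exists ((d \mPo F) * y).
Qed.

End Functional.

Section Specialization.
Variables (K S : comNzRingType) (iota : {rmorphism K -> S}) (n : nat) (x : 'I_n -> S).

Definition spec_var (l : 'I_(n + n)) : {mpoly S[n]} :=
  match split l with inl k => (x k)%:MP | inr k => 'X_k end.

(* [K[X, Y]] seen as polynomials in [Y] with coefficients in [S], a point [x] of
   [S] being substituted for [X]. *)
Definition specialize : {mpoly K[n + n]} -> {mpoly S[n]} :=
  mmap (@mpolyC n S \o iota) spec_var.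
HB.instance Definition _ := GRing.RMorphism.copy specialize
  (mmap (@mpolyC n S \o iota) spec_var).

Lemma specializeX l : specialize 'X_l = spec_var l.
Proof. by rewrite /specialize mmapX mmap1U. Qed.

Lemma specialize_left p : specialize (left_vars p) = (mmap iota x p)%:MP.
Proof.
move: p; apply: (mpoly_rmorph_eq
  (f := specialize \o comp_mpoly [tuple 'X_(lshift n i) | i < n])
  (g := @mpolyC n S \o mmap iota x)) => [c|i] /=.
  by rewrite comp_mpolyC mmapC /specialize mmapC.
rewrite comp_mpolyXU -tnth_nth tnth_mktuple specializeX /spec_var.
by rewrite (unsplitK (inl i)) mmapX mmap1U.
Qed.

Lemma specialize_right p : specialize (right_vars p) = map_mpoly iota p.
Proof.
move: p; apply: (mpoly_rmorph_eq
  (f := specialize \o comp_mpoly [tuple 'X_(rshift n i) | i < n])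
  (g := map_mpoly iota)) => [c|i] /=.
  by rewrite comp_mpolyC /specialize mmapC map_mpolyC.
rewrite comp_mpolyXU -tnth_nth tnth_mktuple specializeX /spec_var.
by rewrite (unsplitK (inr i)) map_mpolyX.
Qed.

Lemma meval_map_mpoly p : (map_mpoly iota p).@[x] = mmap iota x p.
Proof.
move: p; apply: (mpoly_rmorph_eq (f := meval x \o map_mpoly iota) (g := mmap iota x)) => [c|i] /=.
  by rewrite map_mpolyC mevalC mmapC.
by rewrite map_mpolyX mevalXU mmapX mmap1U.
Qed.

Variables (P : 'I_n -> {mpoly K[n]}) (b : 'I_n -> {mpoly K[n + n]}) (i : 'I_n).
Hypothesis certificate : 'X_(lshift n i) - 'X_(rshift n i) =
  \sum_j b j * (left_vars (P j) - right_vars (P j)).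

Definition certificate_coefs : seq S :=
  flatten [seq [seq (specialize (b j))@_m | m <- msupp (specialize (b j))] | j <- enum 'I_n].

(* Applying the graph [G] of an additive map that commutes with the [P j (x)] to the
   coefficients in [Y] of the certificate, and then setting [Y := x], turns the certificate
   into [e = 0]. *)
Lemma certificate_annihilates (G : S -> S -> Prop) (e : S) :
  G 0 0 -> (forall u v u' v', G u v -> G u' v' -> G (u + u') (v + v')) ->
  (forall k u v, G u v -> G (iota k * u) (iota k * v)) ->
  (forall j u v, G u v -> G (mmap iota x (P j) * u) (mmap iota x (P j) * v)) ->
  (forall v, G 0 v -> v = 0) -> G 1 0 -> G (x i) e ->
  (forall u, u \in certificate_coefs -> exists v, G u v) -> e = 0.
Proof.
move=> G0 GD GK GP Gf G1 Gx Gb.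
pose G' (A B : {mpoly S[n]}) := forall m, G A@_m B@_m.
have Gsum (I : Type) (r : seq I) (Q : pred I) (u v : I -> S) : (forall k, G (u k) (v k)) ->
    G (\sum_(k <- r | Q k) u k) (\sum_(k <- r | Q k) v k).
  by move=> Guv; elim/big_rec2: _ => // k u' v' _; exact: GD.
have GN u v : G u v -> G (- u) (- v).
  by move/(GK (- 1)); rewrite rmorphN1 !mulN1r.
pose Q j := (mmap iota x (P j))%:MP - map_mpoly iota (P j).
have GQ j m u v : G u v -> G (u * (Q j)@_m) (v * (Q j)@_m).
  move=> Guv; rewrite mcoeffB mcoeffC mcoeff_map_mpoly !mulrBr.
  apply: (GD); last by apply: (GN); rewrite ![_ * iota _]mulrC; exact: GK.
  case: (m == 0%MM); rewrite ?mulr1 ?mulr0 //.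
  by rewrite ![_ * mmap _ _ _]mulrC; exact: GP.
have G'Q A B j : G' A B -> G' (A * Q j) (B * Q j).
  by move=> GAB m; rewrite !mcoeffM; apply: (Gsum) => k; exact: (GQ).
have lift (B : {mpoly S[n]}) : (forall m, m \in msupp B -> exists y, G B@_m y) -> exists Z, G' B Z.
  move=> BG; have yE m : exists y, G B@_m y.
    have [/BG //|mB] := boolP (m \in msupp B); exists 0; rewrite memN_msupp_eq0 //.
  have [y yP] := choice yE.
  exists (\sum_(m <- msupp B) y m *: 'X_[m]) => m.
  rewrite raddf_sum /=; have [mB|mB] := boolP (m \in msupp B).
    rewrite (bigD1_seq m) ?msupp_uniq //= mcoeffZ mcoeffX eqxx mulr1 big1 ?addr0 // => m' mm.
    by rewrite mcoeffZ mcoeffX (negbTE mm) mulr0.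
  rewrite memN_msupp_eq0 // big_seq big1 => [|m' m'B]; first exact: G0.
  rewrite mcoeffZ mcoeffX; have [E|_] := eqVneq m' m; last by rewrite mulr0.
  by rewrite E (negbTE mB) in m'B.
have /fin_all_exists[Z ZP] : forall j, exists Z, G' (specialize (b j)) Z.
  move=> j; apply: lift => m mB.
  by apply: (Gb); apply/flatten_mapP; exists j; rewrite ?mem_enum //; apply: map_f.
have certE : (x i)%:MP - 'X_i = \sum_j specialize (b j) * Q j.
  have := congr1 specialize certificate; rewrite rmorphB rmorph_sum /= !specializeX.
  rewrite /spec_var (unsplitK (inl i)) (unsplitK (inr i)) => ->.
  by apply: eq_bigr => j _; rewrite rmorphM rmorphB /= specialize_left specialize_right.
(* Coefficient by coefficient, the graph relates [x i - Y_i] to [e], because 1 goes to 0, and the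
   right side of the certificate to the sum of the [Z j * Q j]. The difference of the two sides is
   0, so its image vanishes by [Gf]. *)
have ZE : \sum_j Z j * Q j = e%:MP.
  apply/mpolyP => m; apply/eqP; rewrite -subr_eq0; apply/eqP/Gf.
  have -> : 0 = (\sum_j specialize (b j) * Q j)@_m - ((x i)%:MP - 'X_i)@_m by rewrite certE subrr.
  apply: (GD).
    by rewrite !raddf_sum /=; apply: (Gsum) => j; exact: G'Q.
  apply: (GN); rewrite mcoeffB !mcoeffC mcoeffX.
  rewrite -[e * _]subr0; apply: (GD).
    by case: (m == 0%MM); rewrite ?mulr1 ?mulr0.
  by case: (_ == m); rewrite ?oppr0 //; have := GN _ _ G1; rewrite oppr0.
have := congr1 (meval x) ZE; rewrite mevalC => <-.
rewrite raddf_sum big1 // => j _ /=.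
by rewrite mevalM mevalB mevalC meval_map_mpoly subrr mulr0.
Qed.

End Specialization.

(** * The polynomial inverse of an injective map with constant Jacobian determinant *)

Section Inverse.
Variables (K : numClosedFieldType) (n : nat) (F : n.-tuple {mpoly K[n]}) (c : K).
Hypothesis large_fiber : forall d : K -> nat, exists k, forall N, exists s : seq K,
  [/\ uniq s, size s = N & {in s, forall x, d x = k}].
Hypothesis c0 : c != 0.
Hypothesis detJ : \det (\matrix_(j, k) (tnth F j)^`M(k)) = c%:MP :> {mpoly K[n]}.
Hypothesis F_inj : forall x y : 'I_n -> K,
  (forall j, (tnth F j).@[x] = (tnth F j).@[y]) -> x =1 y.

Lemma mmap_mpolyC_id (p : {mpoly K[n]}) : mmap (@mpolyC n K) (fun i => 'X_i) p = p.
Proof.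
move: p; apply: (mpoly_rmorph_eq (f := mmap (@mpolyC n K) (fun i => 'X_i)) (g := idfun)) => [a|i] /=.
  by rewrite mmapC.
by rewrite mmapX mmap1U.
Qed.

Lemma injective_birational i : exists q p, q != 0 /\ (q \mPo F) * 'X_i = p \mPo F.
Proof.
apply: contrapT => nqp.
have F_free r : r \mPo F = 0 -> r = 0 by exact: (comp_mpoly_eq0 c0 detJ).
have Xi_free q p : (q \mPo F) * 'X_i = p \mPo F -> q = 0.
  by move=> E; apply/eqP; apply: contrapT => /negP q0; apply: nqp; exists q, p.
have [b bE] := injectivity_certificate large_fiber c0 detJ F_inj i.
(* Here the ring [S] of the certificate is the polynomial ring itself and [x] its tuple of
   variables: [specialize] reads K[X, Y] as K[X][Y]. *)
have [G [e [[G0 GD GM Gf] e0 [G1 Gx] Gs]]] := lin_graph_list F_free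
  (certificate_coefs (@mpolyC n K) (fun i => 'X_i) b) Xi_free.
case/eqP: e0; apply: (certificate_annihilates (iota := @mpolyC n K) (x := fun i => 'X_i) bE G0 GD) Gf G1 Gx Gs.
  by move=> k u v Guv; have := GM k%:MP _ _ Guv; rewrite comp_mpolyC.
move=> j u v Guv; rewrite mmap_mpolyC_id.
have := GM ('X_j) _ _ Guv; rewrite comp_mpolyXU -tnth_nth; exact.
Qed.

Lemma injective_inverse : exists Q : 'I_n -> {mpoly K[n]}, forall i, Q i \mPo F = 'X_i.
Proof.
suff Q i : exists g : {mpoly K[n]}, g \mPo F = 'X_i by exact: fin_all_exists Q.
have [q [p [q0 E]]] := injective_birational i.
by have [g gE] := birational_descent c0 detJ q0 E; exists g.
Qed.

End Inverse.

Theorem keller_injective_automorphism (R : realType) n (P : polyvec (complex R) n) :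
  keller P -> injective (polymap P) -> automorphism P.
Proof.
move=> [c c0 detP] Pinj.
pose F := [tuple P j 0 | j < n].
have detJ : \det (\matrix_(j, k) (tnth F j)^`M(k)) = c%:MP.
  by rewrite -detP; congr (\det _); apply/matrixP => j k; rewrite !mxE tnth_mktuple.
have F_inj x y : (forall j, (tnth F j).@[x] = (tnth F j).@[y]) -> x =1 y.
  move=> xy i; have : \col_j x j = \col_j y j.
    apply: Pinj; apply/colP => j; rewrite !mxE; have := xy j; rewrite tnth_mktuple.
    by rewrite !(meval_eq _ (fun l => mxE _ (fun j _ => _) l 0)).
  by move/(congr1 (fun v : 'cV_n => v i 0)); rewrite !mxE.
have [Q QF] := injective_inverse (@complex_large_fiber R) c0 detJ F_inj.
have PE y j : polymap P y j 0 = (tnth F j).@[pt y] by rewrite mxE tnth_mktuple.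
exists (\col_i Q i); split=> y; apply/colP => i.
  rewrite !mxE -[RHS](mevalXU (pt y)) -QF comp_mpoly_meval.
  by apply: meval_eq => j; rewrite mxE tnth_mktuple.
have QFK : forall p, (p \mPo [tuple Q j | j < n]) \mPo F = p.
  apply: (mpoly_rmorph_eq (f := comp_mpoly F \o comp_mpoly [tuple Q j | j < n]) (g := idfun)).
    by move=> a /=; rewrite !comp_mpolyC.
  by move=> l /=; rewrite comp_mpolyXU -tnth_nth tnth_mktuple QF.
(* [QF] gives only a left inverse. Composing [F_i(Q) - X_i] with [F] gives zero, so it is zero by
   algebraic independence of the components of [F]. *)
have FQ : tnth F i \mPo [tuple Q j | j < n] = 'X_i.
  apply/eqP; rewrite -subr_eq0; apply/eqP/(comp_mpoly_eq0 c0 detJ).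
  rewrite rmorphB /= QFK comp_mpolyXU -tnth_nth; exact: subrr.
rewrite !mxE -[RHS](mevalXU (pt y)) -FQ comp_mpoly_meval tnth_mktuple.
by apply: meval_eq => j; rewrite tnth_mktuple /pt !mxE.
Qed.

Theorem theorem1p3 (R : realType) :
  (forall n : nat, (2 <= n)%N ->
     forall P : polyvec R n, dmap P -> injective (polymap P)) ->
  forall n : nat, (2 <= n)%N ->
    forall P : polyvec R[i] n, keller P ->
      injective (polymap P) /\ automorphism P.
Proof.
move=> dmap_inj n _ P PK.
have Pinj : injective (polymap P).
  exact/realmap_injective/(kmap_injective dmap_inj)/realmap_kmap.
by split=> //; exact: keller_injective_automorphism PK Pinj.
Qed.
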